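(* Let $D_n=(\mathcal V,\mathcal A)$ be a digraph of order $n$ with vertex set $\mathcal V=\{v_1,v_2,\ldots,v_n\}$ and arc set $\mathcal A$, let $g_{ij}:=\mathbf I((v_i,v_j)\in\mathcal A)$, let $p_a(i,j):=P((v_i,v_j)\in\mathcal A)$ for $i\neq j$, and let $\rho_a(D_n)=\frac{|\mathcal A|}{n(n-1)}$. (a) If the set $\mathcal A$ of arcs results from a random process, then $\rho_a(D_n)$ is a one-sample $U$-statistic of degree 2. Moreover, if $p_a(i,j)=p_a$ for all $i\neq j$, $i,j=1,2,\ldots,n$ (i.e., the arc probability is constant over pairs of vertices), then $\rho_a(D_n)$ is an unbiased estimator of $p_a$. (b) Suppose the set $\mathcal A$ of arcs results from a random process such that the $g_{ij}$ are identically distributed with $p_a(i,j)=p_a$ for all $i\neq j$, $i,j=1,\ldots,n$; $g_{ij}$ and $g_{kl}$ are independent for distinct $i,j,k,l$; and $\mathbf{Cov}(g_{ij},g_{kl})>0$ for all $i\neq j$ and $k\neq l$ in $\{1,\ldots,n\}$ such that exactly one of $i,j$ is equal to exactly one of $k,l$. Then $$\sqrt n\,\bigl[\rho_a(D_n)-p_a\bigr]\stackrel{\mathcal L}{\longrightarrow}\mathcal N(0,\nu_a)\quad\text{as } n\to\infty,$$ where $\nu_a=\lim_{n\to\infty}n\,\mathbf{Var}[\rho_a(D_n)]$.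
   Context: $\mathbf I(\cdot)$ is the indicator function and $|\cdot|$ denotes cardinality. Arcs are ordered pairs of distinct vertices. The relative arc density $\rho_a(D_n)$ is the ratio of the number of arcs of $D_n$ to the number of arcs of the complete digraph of order $n$. ''$\mathcal A$ results from a random process'' means that $\mathcal A$ is random, so $D_n$ is a random digraph. ''One-sample $U$-statistic of degree 2'' is used in the sense that the statistic equals $\binom n2^{-1}\sum_{i<j}h_{ij}$ with a symmetric kernel ($h_{ij}=h_{ji}$), here $h_{ij}=(g_{ij}+g_{ji})/2$. $\stackrel{\mathcal L}{\longrightarrow}$ denotes convergence in law and $\mathcal N(\mu,\sigma^2)$ the normal distribution with mean $\mu$ and variance $\sigma^2$. In (b), $p_a$ is a constant that depends neither on the indices nor on $n$.
   Formalization: In (b), independence of g_ij and g_kl for distinct i,j,k,l is strengthened to joint independence of the families of arc indicators on any two vertex-disjoint arc sets (pairwise independence alone makes (b) false), and the limit defining ν_a is assumed to exist. *)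

(* Defs.v *)
From HB Require Import structures.
From mathcomp Require Import all_boot all_order all_algebra.
From mathcomp Require Import all_classical all_reals all_analysis.
Set Implicit Arguments.
Unset Strict Implicit.
Unset Printing Implicit Defensive.
Import Order.TTheory GRing.Theory Num.Theory.
Import numFieldNormedType.Exports.
Local Open Scope classical_set_scope.
Local Open Scope ring_scope.

Record digraph (n : nat) := Digraph {
  arcs : {set 'I_n * 'I_n};
  arcs_loopless : forall i, (i, i) \notin arcs }.

(* There are finitely many digraphs on 'I_n; they carry the discrete
   sigma-algebra, so every set of digraphs must have a measurable preimage. *)
Record random_digraph d (T : measurableType d) (n : nat) := RandomDigraph {
  rdigraph :> T -> digraph n;
  measurable_rdigraph : forall B : set (digraph n),
    measurable (rdigraph @^-1` B) }.

Section ArcDensity.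
Context d (T : measurableType d) (R : realType) (n : nat).
Implicit Type D : random_digraph T n.

Definition arc_event D (i j : 'I_n) : set T := [set w | (i, j) \in arcs (D w)].

Definition arc_prob (P : probability T R) D i j : \bar R :=
  P (arc_event D i j).

Definition arc_ind D (i j : 'I_n) : T -> R := \1_(arc_event D i j).

(* n * (n - 1) is the number of arcs of the complete digraph of order n. *)
Definition arc_density D (w : T) : R :=
  #|arcs (D w)|%:R / (n * (n - 1))%:R.

Definition arc_kernel D (i j : 'I_n) : T -> R :=
  fun w => (arc_ind D i j w + arc_ind D j i w) / 2.

Definition is_Ustatistic2 (h : 'I_n -> 'I_n -> T -> R) (U : T -> R) : Prop :=
  [/\ forall i j, measurable_fun setT (h i j),
      forall i j, h i j = h j i
    & forall w, U w = 'C(n, 2)%:R^-1 * \sum_(i < n) \sum_(j < n | (i < j)%N) h i j w].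

End ArcDensity.

Section RandomVariables.
Context d (T : measurableType d) (R : realType) (P : probability T R).

Definition unbiased_estimator (X : T -> R) (theta : R) : Prop :=
  'E_P[X]%E = theta%:E.

Definition identically_distributed (X Y : T -> R) : Prop :=
  forall B : set R, measurable B -> P (X @^-1` B) = P (Y @^-1` B).

(* Independence of the sigma-algebras generated by (X e), e in E, and by
   (X f), f in F, expressed on the pi-systems of finite rectangles. *)
Definition independent_families (I : finType) (X : I -> T -> R)
    (E F : {set I}) : Prop :=
  forall A B : I -> set R,
    (forall e, measurable (A e)) -> (forall f, measurable (B f)) ->
  let EA := \bigcap_(e in [set` E]) (X e @^-1` A e) in
  let FB := \bigcap_(f in [set` F]) (X f @^-1` B f) in
  P (EA `&` FB) = (P EA * P FB)%E.

End RandomVariables.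

(* (i, j) and (k, l) with i, j, k, l distinct. *)
Definition vertex_disjoint n (e f : 'I_n * 'I_n) : bool :=
  uniq [:: e.1; e.2; f.1; f.2].

(* g_ij and g_kl are independent for distinct i, j, k, l, for whole families:
   the indicators of two sets of arcs that have no vertex in common are
   independent.  E = {(i, j)} and F = {(k, l)} give the case of two arcs; this
   case alone (pairwise independence) does not imply the central limit
   theorem, even for vertex-exchangeable random digraphs. *)
Definition disjoint_arcs_independent d (T : measurableType d) (R : realType)
    (P : probability T R) n (D : random_digraph T n) : Prop :=
  forall E F : {set 'I_n * 'I_n},
    (forall e f, e \in E -> f \in F -> vertex_disjoint e f) ->
  independent_families P (fun e => arc_ind R D e.1 e.2) E F.

(* Normal law of mean m and variance v.  The degenerate law is the Dirac mass:
   normal_prob m 0 is the uniform law on [0, 1]. *)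
Definition normal_law (R : realType) (m v : R) :
    probability (measurableTypeR R) R :=
  if v == 0 then (\d_(m : measurableTypeR R) : probability _ R)
  else (normal_prob m (Num.sqrt v) : probability _ R).

(* The X n may live on different probability spaces. *)
Definition cvg_in_law (R : realType) (d : nat -> measure_display)
    (T : forall n, measurableType (d n)) (P : forall n, probability (T n) R)
    (X : forall n, T n -> R) (L : probability (measurableTypeR R) R) : Prop :=
  forall x : R, {for x, continuous (fun y : R => L [set z | z <= y])} ->
    P n [set w | X n w <= x] @[n --> \oo] --> L [set z | z <= x].

(* Main.v *)
Require Import Defs.
From HB Require Import structures.
From mathcomp Require Import all_boot all_order all_algebra.
From mathcomp Require Import all_classical all_reals all_analysis.
From mathcomp Require Import measurable_realfun ring lra zify.
Set Implicit Arguments.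
Unset Strict Implicit.
Unset Printing Implicit Defensive.
Import Order.TTheory GRing.Theory Num.Theory.
Import numFieldNormedType.Exports.
Local Open Scope ring_scope.

(** The density is a U-statistic because the sum over ordered pairs of distinct
    vertices can be regrouped over the pairs [i < j]; it is unbiased by
    linearity of the expectation.

    Its asymptotic normality is a central limit theorem for the locally
    dependent array [Y_e = g_e - p], [e] ranging over the [n (n - 1)] arcs.  An
    arc shares a vertex with at most [4 n] others, and families of arcs without
    common vertex are independent.  Write [W = c * \sum_e Y_e], with [c] of order
    [n^(-3/2)], for the normalised density.  Stein's method applies: if [f'] is
    bounded and Lipschitz, replacing [W] in [f W] by the sum over the arcs not
    meeting [e], which is independent of [Y_e], and expanding to first order
    gives
      [E (W f W) = E (S f' W) + O (c^3 n^2 n^2)],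
      [S = c^2 \sum_e \sum_(e' meets e) Y_e Y_e'].
    Here [E S = E W^2], and by local dependence again [S] has variance
    [O (c^4 n^2 n^3)]; hence [E (W f W) - E W^2 * E (f' W) = O (n^(-1/2))]
    ([stein_local_dependence], [stein_arc_sum]).

    To conclude when [nu > 0], let [Phi] and [phi] be the distribution function
    and density of N(0, nu).  For a piecewise linear ramp [r] falling from 1 to
    0 between levels [a < b] in ]0, 1[, the equation
      [f' x - x / nu * f x = r (Phi x) - (a + b) / 2]
    has the solution [(\int_0^(Phi x) r - (a + b) / 2 * Phi x) / phi x], and
    Mills' inequalities bound [f'] and its Lipschitz constant.  As [E W^2]
    tends to [nu], the mean of [r (Phi W)] tends to [(a + b) / 2].  Two steep
    ramps squeeze the indicator of [W <= x], one with [a = Phi x] from above and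
    one with [b = Phi x] from below.  When [nu = 0], Chebyshev's
    inequality gives the convergence to the Dirac mass, whose distribution
    function is discontinuous at 0 only.

    All expectations involved are finite sums: a random digraph of order [n]
    is seen through the law of its arc set, a probability vector indexed by
    the sets of pairs of vertices ([arc_law], [expectation_arcs]). *)

(** * Differential calculus on the real line *)

Section Calculus.
Local Open Scope classical_set_scope.
Local Open Scope ring_scope.
Context {R : realType}.
Implicit Types (f df : R -> R) (x y a b u v : R).

Lemma mean_value f df a b : a <= b ->
  (forall x, a <= x <= b -> is_derive x 1 f (df x)) ->
  exists2 c, a <= c <= b & f b - f a = df c * (b - a).
Proof.
move=> ab fdf; have [||c cab ->] := @MVT_segment R f df a b ab.
- by move=> x; rewrite in_itv/= => /andP[ax xb]; apply: fdf; rewrite !ltW.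
- apply: continuous_in_subspaceT => x; rewrite inE/= in_itv/= => xab.
  apply: differentiable_continuous; apply/derivable1_diffP.
  by have [] := fdf x xab.
- by exists c => //; rewrite in_itv/= in cab.
Qed.

Lemma bounded_derive_lipschitz f df K : (forall x, is_derive x 1 f (df x)) ->
  (forall x, `|df x| <= K) -> forall x y, `|f x - f y| <= K * `|x - y|.
Proof.
move=> fdf dfK x y; wlog xy : x y / x <= y => [hw|].
  have [/hw//|/ltW/hw] := leP x y.
  by rewrite distrC (distrC x).
have [c _ h] := mean_value xy (fun z _ => fdf z).
by rewrite distrC h normrM (distrC x) ler_wpM2r.
Qed.

(** By the mean value theorem the remainder is [(df z - df x) * (x - y)] for some
    [z] between [x] and [y]. *)
Lemma taylor_lipschitz f df K : (forall x, is_derive x 1 f (df x)) ->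
  (forall x y, `|df x - df y| <= K * `|x - y|) ->
  forall x y, `|f x - f y - df x * (x - y)| <= K * (x - y) ^+ 2.
Proof.
move=> fdf dfK x y.
have K0 : 0 <= K.
  by have := le_trans (normr_ge0 _) (dfK 1 0); rewrite subr0 normr1 mulr1.
have key z w : z <= w -> forall v, z <= v <= w ->
    `|f w - f z - df v * (w - z)| <= K * (w - z) ^+ 2.
  move=> zw v /andP[zv vw]; have [c /andP[zc cw] ->] := mean_value zw (fun z _ => fdf z).
  rewrite -mulrBl normrM expr2 mulrA (@ger0_norm _ (w - z)) ?subr_ge0//.
  rewrite ler_wpM2r ?subr_ge0//; apply: le_trans (dfK _ _) _.
  by rewrite ler_wpM2l// ler_norml; apply/andP; split; lra.
have [xy|/ltW yx] := leP x y.
- have := key _ _ xy x; rewrite lexx xy => /(_ isT).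
  by rewrite -normrN -sqrrN; congr (`|_| <= _ * _ ^+ 2); ring.
- by have := key _ _ yx x; rewrite lexx yx => /(_ isT).
Qed.

(** This criterion differentiates a piecewise quadratic function without any
    case analysis at the points where two pieces meet. *)
Lemma quadratic_is_derive f x l K :
  (forall y, `|f y - f x - l * (y - x)| <= K * (y - x) ^+ 2) ->
  is_derive x 1 f l.
Proof.
move=> fK; have cv : h^-1 *: (f (h *: 1 + x) - f x) @[h --> 0^'] --> l.
  apply/cvgrPdist_le => e e0.
  have K0 : 0 <= K.
    by have := le_trans (normr_ge0 _) (fK (x + 1)); rewrite addrAC subrr add0r expr1n mulr1.
  near=> h.
  have h0 : h != 0 by near: h; exact: nbhs_dnbhs_neq.
  have := fK (h *: 1 + x).
  rewrite [h *: 1]mulr1 addrK => fh.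
  have -> : l - h^-1 *: (f (h + x) - f x) = - h^-1 * (f (h + x) - f x - l * h).
    by rewrite [_ *: _]/(_ * _) mulrBr mulNr mulNr opprK mulrCA mulVf// mulr1 addrC.
  rewrite normrM normrN normfV ler_pdivrMl ?normr_gt0//.
  apply: le_trans fh _; rewrite -real_normK ?num_real// expr2 mulrCA.
  rewrite ler_wpM2l//.
  have hK : `|h| <= e / (K + 1).
    near: h; apply: dnbhs0_le.
    by rewrite divr_gt0// ltr_wpDl.
  apply: le_trans (_ : (K + 1) * `|h| <= _); first by rewrite ler_wpM2r// lerDl.
  by rewrite mulrC -ler_pdivlMr// ltr_wpDl.
split; last exact: cvg_lim cv.
by apply/cvg_ex; exists l.
Unshelve. all: by end_near. Qed.

Lemma is_derive_ratio f g x (df dg : R) : g x != 0 ->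
  is_derive x 1 f df -> is_derive x 1 g dg ->
  is_derive x 1 (fun y => f y / g y) ((df * g x - f x * dg) / g x ^+ 2).
Proof.
move=> g0 fdf gdg; have hV := is_deriveV g0 gdg.
have -> : (fun y => f y / g y) = f * (fun y => (g y)^-1) by [].
by apply: is_derive_eq; rewrite /GRing.scale/=; field.
Qed.

End Calculus.

(** * Ramps and their primitives *)

Section Ramp.
Context {R : realType}.
Implicit Types a b u v : R.

Definition pospart u : R := Num.max u 0.

Lemma pospart_id u : 0 <= u -> pospart u = u.
Proof. exact: max_l. Qed.

Lemma pospart_eq0 u : u <= 0 -> pospart u = 0.
Proof. exact: max_r. Qed.

Lemma pospart_lipschitz u v : `|pospart u - pospart v| <= `|u - v|.
Proof.
have [u0|/ltW u0] := leP 0 u; have [v0|/ltW v0] := leP 0 v;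
  rewrite ?(pospart_id u0) ?(pospart_id v0) ?(pospart_eq0 u0) ?(pospart_eq0 v0)//.
- by rewrite subr0 ger0_norm// (le_trans _ (ler_norm _))//; lra.
- by rewrite sub0r normrN ger0_norm// distrC (le_trans _ (ler_norm _))//; lra.
- by rewrite subrr normr0.
Qed.

(** The increment minus its linear part always lies between 0 and
    [(v - u) ^+ 2]. *)
Lemma is_derive_pospart_sqr u :
  is_derive u 1 (fun v => pospart v ^+ 2) (2 * pospart u).
Proof.
apply: (@quadratic_is_derive _ _ _ _ 1) => v; rewrite mul1r ler_norml.
have [u0|/ltW u0] := leP 0 u; have [v0|/ltW v0] := leP 0 v;
  rewrite ?(pospart_id u0) ?(pospart_id v0) ?(pospart_eq0 u0) ?(pospart_eq0 v0)//;
  rewrite ?expr0n ?mulr0 ?mul0r/=.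
- have sq := sqr_ge0 (v - u).
  have -> : v ^+ 2 - u ^+ 2 - 2 * u * (v - u) = (v - u) ^+ 2 by ring.
  by rewrite lexx andbT (le_trans _ sq)// oppr_le0.
- have : 0 <= u * - v by rewrite mulr_ge0// oppr_ge0.
  by move=> uv; apply/andP; split; nra.
- have : 0 <= - u * v by rewrite mulr_ge0// oppr_ge0.
  by have := sqr_ge0 (v - u); have := sqr_ge0 u; move=> ? ? ?; apply/andP; split; nra.
- by have := sqr_ge0 (v - u); move=> ?; apply/andP; split; lra.
Qed.

(** For [a < b]: 1 up to [a], 0 from [b] on, and affine in between. *)
Definition ramp a b u : R := (pospart (b - u) - pospart (a - u)) / (b - a).

(** The primitive of [ramp a b] that vanishes at 0 when [0 <= a]; written with
    squares of positive parts, it is differentiable by a single formula. *)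
Definition ramp_prim a b u : R :=
  (b ^+ 2 - a ^+ 2 - pospart (b - u) ^+ 2 + pospart (a - u) ^+ 2)
  / (2 * (b - a)).

Lemma is_derive_ramp_prim a b u : a < b ->
  is_derive u 1 (ramp_prim a b) (ramp a b u).
Proof.
move=> ab.
have D c : is_derive u 1 (fun v => pospart (c - v) ^+ 2) (- (2 * pospart (c - u))).
  have h : is_derive u 1 (fun v : R => c - v) (-1).
    by apply: is_derive_eq; rewrite add0r mul1r.
  have := @is_derive1_comp _ (fun v => pospart v ^+ 2) (fun v : R => c - v) u _ _
    (is_derive_pospart_sqr _) h.
  by rewrite mulrN1.
have -> : ramp_prim a b = (fun v => (2 * (b - a))^-1 *: (b ^+ 2 - a ^+ 2
    - pospart (b - v) ^+ 2 + pospart (a - v) ^+ 2)).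
  by apply/funext => v; rewrite /ramp_prim mulrC.
have Db := D b; have Da := D a.
apply: is_derive_eq; rewrite /ramp /GRing.scale/=.
have ba : b - a != 0 by rewrite subr_eq0 gt_eqF.
field.
by rewrite ba.
Qed.

Lemma ramp_left a b u : a < b -> u <= a -> ramp a b u = 1.
Proof.
move=> ab ua; rewrite /ramp !pospart_id ?subr_ge0//; last by rewrite (le_trans ua)// ltW.
have -> : b - u - (a - u) = b - a by ring.
by rewrite divff// subr_eq0 gt_eqF.
Qed.

Lemma ramp_right a b u : a < b -> b <= u -> ramp a b u = 0.
Proof.
move=> ab bu; rewrite /ramp !pospart_eq0 ?subr_le0 ?subrr ?mul0r//.
by rewrite (le_trans _ bu)// ltW.
Qed.

Lemma ramp_bound a b u : a < b -> 0 <= ramp a b u <= 1.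
Proof.
move=> ab; have ba : 0 < b - a by rewrite subr_gt0.
have [ua|au] := leP u a; first by rewrite ramp_left// ler01 lexx.
have [bu|ub] := leP b u; first by rewrite ramp_right// ler01 lexx.
rewrite /ramp pospart_id ?subr_ge0 ?(ltW ub)// pospart_eq0 ?subr_le0 ?(ltW au)//.
rewrite subr0 divr_ge0 ?subr_ge0 ?(ltW ub) ?(ltW ab)//= ler_pdivrMr//; lra.
Qed.

Lemma ramp_lipschitz a b u v : a < b ->
  `|ramp a b u - ramp a b v| <= 2 / (b - a) * `|u - v|.
Proof.
move=> ab; rewrite /ramp -mulrBl normrM [leRHS]mulrAC (@ger0_norm _ (b - a)^-1) ?invr_ge0 ?subr_ge0 ?(ltW ab)//.
rewrite ler_pM2r ?invr_gt0 ?subr_gt0//.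
have -> : pospart (b - u) - pospart (a - u) - (pospart (b - v) - pospart (a - v))
  = (pospart (b - u) - pospart (b - v)) - (pospart (a - u) - pospart (a - v)) by ring.
apply: le_trans (ler_normB _ _) _.
have h c : `|pospart (c - u) - pospart (c - v)| <= `|u - v|.
  apply: le_trans (pospart_lipschitz _ _) _.
  by rewrite (_ : c - u - (c - v) = v - u) ?(distrC u)//; ring.
by rewrite mulr_natl mulr2n lerD.
Qed.

Lemma ramp_prim0 a b : 0 < a -> a < b -> ramp_prim a b 0 = 0.
Proof.
move=> a0 ab; rewrite /ramp_prim !subr0 !pospart_id ?ltW// ?(lt_trans a0)//.
by rewrite addrAC subrK subrr mul0r.
Qed.

Lemma ramp_prim_left a b u : a < b -> u <= a -> ramp_prim a b u = u.
Proof.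
move=> ab ua; rewrite /ramp_prim !pospart_id ?subr_ge0//; last by rewrite (le_trans ua)// ltW.
by have ba : b - a != 0 by [rewrite subr_eq0 gt_eqF]; field.
Qed.

Lemma ramp_prim_right a b u : a < b -> b <= u -> ramp_prim a b u = (a + b) / 2.
Proof.
move=> ab bu; rewrite /ramp_prim !pospart_eq0 ?subr_le0//; last by rewrite (le_trans _ bu)// ltW.
by have ba : b - a != 0 by [rewrite subr_eq0 gt_eqF]; field.
Qed.

(** The function of [u] bounded here vanishes at 0 and at 1, since the integral
    of the ramp over [0, 1] is [(a + b) / 2], and its derivative is at most 1 in
    absolute value. *)
Lemma ramp_prim_bound a b u : 0 < a -> a < b -> b < 1 -> 0 <= u <= 1 ->
  `|ramp_prim a b u - (a + b) / 2 * u| <= u /\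
  `|ramp_prim a b u - (a + b) / 2 * u| <= 1 - u.
Proof.
move=> a0 ab b1 /andP[u0 u1].
pose g u := ramp_prim a b u - (a + b) / 2 * u.
have dg (x : R) : is_derive x 1 g (ramp a b x - (a + b) / 2).
  have := is_derive_ramp_prim x ab => h.
  have -> : g = (fun v => ramp_prim a b v - ((a + b) / 2) *: v) by [].
  by apply: is_derive_eq; rewrite [_ *: _]mulr1.
have g1 x : `|ramp a b x - (a + b) / 2| <= 1.
  by have /andP[r0 r1] := ramp_bound x ab; rewrite ler_norml; apply/andP; split; lra.
have L := bounded_derive_lipschitz dg g1.
have gu0 : g 0 = 0 by rewrite /g ramp_prim0// mulr0 subrr.
have gu1 : g 1 = 0 by rewrite /g ramp_prim_right ?ltW// mulr1 subrr.
split.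
- by have := L u 0; rewrite gu0 !subr0 mul1r (ger0_norm u0).
- by have := L u 1; rewrite gu1 !subr0 mul1r (distrC u) [X in _ <= X]ger0_norm ?subr_ge0.
Qed.

End Ramp.

(** * Density and distribution function of the normal law *)

Section NormalCdf.
Local Open Scope classical_set_scope.
Local Open Scope ring_scope.
Context {R : realType}.
Implicit Types s x : R.

Definition normal_cdf s x : R := fine (normal_prob 0 s `]-oo, x]).

Lemma normal_cdfE s x : (normal_cdf s x)%:E = normal_prob 0 s `]-oo, x].
Proof. by rewrite fineK// fin_num_measure. Qed.

Lemma normal_cdf_ge0 s x : 0 <= normal_cdf s x.
Proof. by rewrite fine_ge0. Qed.

Lemma normal_cdf_le1 s x : normal_cdf s x <= 1.
Proof. by rewrite -lee_fin normal_cdfE; exact: probability_le1. Qed.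

Lemma normal_cdf_itv s x : 0 <= normal_cdf s x <= 1.
Proof. by rewrite normal_cdf_ge0 normal_cdf_le1. Qed.

Lemma is_derive_normal_cdf s x : s != 0 ->
  is_derive x 1 (normal_cdf s) (normal_pdf 0 s x).
Proof.
move=> s0; have := @continuous_FTC1 _ (normal_pdf 0 s) -oo%O x (x + 1).
rewrite ltrDl ltr01 => /(_ isT); case.
- apply: (integrableS _ _ (subsetT _)) => //; exact: integrable_normal_pdf.
- by rewrite ltNyr.
- exact: continuous_normal_pdf.
- move=> d1 d2; split; first exact: d1.
  by rewrite -derive1E.
Qed.

Lemma is_derive_normal_pdf s x : s != 0 ->
  is_derive x 1 (normal_pdf 0 s) (- (x / s ^+ 2) * normal_pdf 0 s x).
Proof.
move=> s0; rewrite normal_pdfE//.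
pose q y : R := - (y ^+ 2) * (s ^+ 2 *+ 2)^-1.
have dq : is_derive x 1 q (- (x / s ^+ 2)).
  have -> : q = (fun y : R => - ((s ^+ 2 *+ 2)^-1 *: y ^+ 2)).
    by apply/funext => y; rewrite /q mulNr mulrC.
  apply: is_derive_eq; rewrite /GRing.scale/=.
  by field.
have -> : (fun y : R => normal_peak s * normal_fun 0 s y) = (fun y => normal_peak s *: expR (q y)).
  by apply/funext => y; rewrite /normal_fun subr0.
have h := @is_derive1_comp _ expR q x _ _ (is_derive_expR _) dq.
apply: is_derive_eq; rewrite /GRing.scale/=.
by rewrite /normal_fun subr0 -/(q x) mulrA mulrC.
Qed.

Lemma normal_pdf_gt0 s x : s != 0 -> 0 < normal_pdf 0 s x.
Proof. by move=> s0; rewrite normal_pdfE// mulr_gt0 ?normal_peak_gt0 ?expR_gt0. Qed.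

Lemma normal_pdf_sym s x : s != 0 -> normal_pdf 0 s (- x) = normal_pdf 0 s x.
Proof. by move=> s0; rewrite normal_pdfE// /normal_fun !subr0 sqrrN. Qed.

Lemma normal_pdf_anti s x M : s != 0 -> `|x| <= M -> normal_pdf 0 s M <= normal_pdf 0 s x.
Proof.
move=> s0 xM; rewrite normal_pdfE// ler_pM2l ?normal_peak_gt0// ler_expR !subr0.
rewrite ler_pM2r ?invr_gt0 ?mulrn_wgt0 ?exprn_even_gt0// lerN2.
by rewrite -(real_normK (num_real x)) lerXn2r// nnegrE (le_trans _ xM).
Qed.

(* The identity, as a random variable whose law is the normal law: its
   distribution function is [normal_cdf s]. *)
Let idTR : measurableTypeR R -> R := idfun.

#[local] HB.instance Definition _ :=
  @isMeasurableFun.Build _ _ _ _ idTR (@measurable_id _ _ setT).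

Let cdf_idTR s : cdf (idTR : {RV (normal_prob 0 s) >-> R}) = EFin \o normal_cdf s.
Proof. by apply/funext => x /=; rewrite normal_cdfE. Qed.

Lemma normal_cdfNy0 s : normal_cdf s x @[x --> -oo] --> (0 : R).
Proof.
have := cvg_cdfNy0 (idTR : {RV (normal_prob 0 s) >-> R}).
by rewrite cdf_idTR => /fine_cvg.
Qed.

Lemma normal_cdfy1 s : normal_cdf s x @[x --> +oo] --> (1 : R).
Proof.
have := cvg_cdfy1 (idTR : {RV (normal_prob 0 s) >-> R}).
by rewrite cdf_idTR => /fine_cvg.
Qed.
End NormalCdf.

(** * Mills' inequalities *)

Section Mills.
Local Open Scope classical_set_scope.
Local Open Scope ring_scope.
Context {R : realType}.
(* [phi] is a positive multiple of the centred Gaussian density of variance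
   [1 / t] and [F] is its left tail.  The reflected right tail satisfies the same
   hypotheses, so that each bound below serves on both sides. *)
Variables (t : R) (F phi : R -> R).
Hypothesis t0 : 0 < t.
Hypothesis phi0 : forall x, 0 < phi x.
Hypothesis dF : forall x : R, is_derive x 1 F (phi x).
Hypothesis dphi : forall x : R, is_derive x 1 phi (- (t * x) * phi x).
Hypothesis F0 : forall x, 0 <= F x.
Hypothesis FNy : F x @[x --> -oo] --> (0 : R).
Implicit Types x y : R.

Let t_ge0 : 0 <= t. Proof. exact: ltW. Qed.
Let phi_ge0 x : 0 <= phi x. Proof. exact: ltW. Qed.

Lemma tail_small x e : 0 < e -> exists2 y, y <= x & F y <= e.
Proof.
move=> e0; have He : \forall y \near -oo, `|F y| <= e by exact: cvgr0_norm_le.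
have Hx : \forall y \near -oo, y <= x by apply: nbhs_ninfty_le; exact: num_real.
have [y [Fy yx]] := @filter_ex _ _ _ _ (filterI He Hx).
by exists y => //; rewrite (le_trans (ler_norm _)).
Qed.

Lemma ge0_from_left (r dr : R -> R) x :
  (forall y, y <= x -> is_derive y 1 r (dr y)) ->
  (forall y, y <= x -> 0 <= dr y) ->
  (forall e, 0 < e -> exists2 y, y <= x & - e <= r y) -> 0 <= r x.
Proof.
move=> rdr dr0 rNy; rewrite -[r x]addr0; apply/ler_addgt0Pl => e e0.
have [y yx ry] := rNy _ e0.
have [z /andP[yz zx] rE] := mean_value yx (fun z (yzx : y <= z <= x) =>
   rdr z (proj2 (andP yzx))).
have : 0 <= r x - r y by rewrite rE mulr_ge0 ?dr0// subr_ge0.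
lra.
Qed.

(** The function [r] below is nondecreasing on the negative axis, because its
    derivative is [phi y / (t * y ^+ 2)], and it is at least [- F y], which
    tends to 0 at minus infinity. *)
Lemma mills_upper x : x < 0 -> t * - x * F x <= phi x.
Proof.
move=> x0.
pose r y := phi y / (t * - y) - F y.
have dr y : y < 0 -> is_derive y 1 r (phi y / (t * y ^+ 2)).
  move=> y0.
  have dl : is_derive y 1 (fun z : R => t *: - z) (- t).
    by apply: is_derive_eq; rewrite /GRing.scale/= mulrN1.
  have ty0 : t *: - y != 0 by rewrite mulf_neq0 ?gt_eqF// oppr_gt0.
  have dq := @is_derive_ratio _ phi (fun z : R => t *: - z) y _ _ ty0 (dphi y) dl.
  have -> : r = (fun z => phi z / (t *: - z)) - F by [].
  apply: is_derive_eq; rewrite /GRing.scale/=.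
  field.
  by rewrite lt_eqF// gt_eqF.
suff : 0 <= r x.
  by rewrite /r subr_ge0 ler_pdivlMr ?mulr_gt0 ?oppr_gt0// [F x * _]mulrC.
apply: (@ge0_from_left _ (fun y => phi y / (t * y ^+ 2))).
- by move=> y yx; apply: dr; exact: le_lt_trans x0.
- by move=> y _; rewrite divr_ge0// mulr_ge0// sqr_ge0.
- move=> e e0; have [y yx Fy] := tail_small x e0.
  exists y => //; rewrite /r.
  suff : 0 <= phi y / (t * - y) by lra.
  by rewrite divr_ge0 ?mulr_ge0 ?oppr_ge0 ?(ltW (le_lt_trans yx x0)).
Qed.

(** The derivative of [F y + y * phi y / (1 + t * y ^+ 2)] simplifies to
    [2 * phi y / (1 + t * y ^+ 2) ^+ 2], and the second term of this sum tends
    to 0 at minus infinity. *)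
Lemma mills_lower x : x < 0 -> - x * phi x <= (1 + t * x ^+ 2) * F x.
Proof.
move=> x0.
have den y : 0 < 1 + t * y ^+ 2 by rewrite ltr_wpDr// mulr_ge0// sqr_ge0.
pose r y := F y + y * phi y / (1 + t * y ^+ 2).
have dr y : is_derive y 1 r (2 * phi y / (1 + t * y ^+ 2) ^+ 2).
  have dl : is_derive y 1 (fun z : R => 1 + t *: z ^+ 2) (2 * t * y).
    by apply: is_derive_eq; rewrite /GRing.scale/=; ring.
  have dn : is_derive y 1 (id * phi) (phi y - t * y ^+ 2 * phi y).
    by have := dphi y => ?; apply: is_derive_eq; rewrite /GRing.scale/=; ring.
  have ty0 : 1 + t *: y ^+ 2 != 0 by rewrite gt_eqF//; exact: den.
  have dq := @is_derive_ratio _ (id * phi) (fun z : R => 1 + t *: z ^+ 2) y _ _ ty0 dn dl.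
  have -> : r = F + (fun z => (id * phi) z / (1 + t *: z ^+ 2)) by [].
  apply: is_derive_eq; rewrite /GRing.scale/=.
  change ((id * phi) y) with (y * phi y).
  field.
  by rewrite gt_eqF.
suff : 0 <= r x.
  rewrite /r -lerBlDr sub0r -mulNr -mulNr ler_pdivrMr//.
  by rewrite [F x * _]mulrC.
apply: (ge0_from_left (fun y _ => dr y)).
  by move=> y _; rewrite divr_ge0 ?sqr_ge0// mulr_ge0.
move=> e e0; pose y := x - phi x / (t * e).
have yx : y <= x by rewrite gerBl divr_ge0 ?mulr_ge0// ?(ltW e0).
have y0 : y < 0 by exact: le_lt_trans x0.
exists y => //.
(* As [phi] increases on the negative axis, a point [y] far enough to the left
   makes [- y * phi x] smaller than [e * t * y ^+ 2]. *)
have phiyx : phi y <= phi x.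
  have [z /andP[yz zx] phiE] := mean_value yx (fun z _ => dphi z).
  rewrite -subr_ge0 phiE mulr_ge0 ?subr_ge0// mulr_ge0//.
  by rewrite -mulrN mulr_ge0 ?oppr_ge0// (le_trans zx)// ltW.
have phix : phi x <= t * e * - y.
  rewrite mulrC -ler_pdivrMr ?mulr_gt0//; rewrite /y; lra.
suff : - e <= y * phi y / (1 + t * y ^+ 2) by have := F0 y; rewrite /r; lra.
rewrite ler_pdivlMr//.
suff : - y * phi y <= e * (t * y ^+ 2) by lra.
apply: le_trans (_ : - y * (t * e * - y) <= _).
  by rewrite ler_wpM2l ?oppr_ge0 ?(ltW y0)// (le_trans phiyx).
by rewrite le_eqVlt; apply/orP; left; apply/eqP; ring.
Qed.

(** Second order bound: the leading terms of [t * x ^+ 2 * F x] and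
    [- x * phi x] cancel.  It controls the second derivative of the solution of
    Stein's equation in the tails. *)
Lemma mills_second x : x <= -1 ->
  0 <= (1 + t * x ^+ 2) * F x / phi x + x <= t^-1.
Proof.
move=> x1; have x0 : x < 0 by rewrite (le_lt_trans x1)// ltrN10.
have mu := mills_upper x0; have ml := mills_lower x0.
apply/andP; split; first by rewrite -lerBlDr sub0r ler_pdivlMr.
rewrite -lerBrDr ler_pdivrMr// mulrBl mulrDl mul1r.
have h1 : t * x ^+ 2 * F x <= - x * phi x.
  have -> : t * x ^+ 2 * F x = - x * (t * - x * F x) by ring.
  by rewrite ler_wpM2l// oppr_ge0 ltW.
have h2 : F x <= t^-1 * phi x.
  rewrite mulrC ler_pdivlMr// mulrC.
  apply: le_trans mu; rewrite -mulrA ler_wpM2l// ler_peMl//; lra.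
lra.
Qed.
End Mills.

(** * Solution of Stein's equation *)

Section NormalMills.
Local Open Scope classical_set_scope.
Local Open Scope ring_scope.
Context {R : realType}.
Variable s : R.
Hypothesis s0 : 0 < s.
Local Notation t := ((s ^+ 2)^-1).
Local Notation Phi := (normal_cdf s).
Local Notation phi := (normal_pdf 0 s).
Implicit Types x y : R.

Let s_neq0 : s != 0. Proof. by rewrite gt_eqF. Qed.
Let t0 : 0 < t. Proof. by rewrite invr_gt0 exprn_gt0. Qed.
Let phi0 x : 0 < phi x. Proof. exact: normal_pdf_gt0. Qed.
Let dPhi (x : R) : is_derive x 1 Phi (phi x). Proof. exact: is_derive_normal_cdf. Qed.
Let dphi (x : R) : is_derive x 1 phi (- (t * x) * phi x).
Proof. by have := is_derive_normal_pdf x s_neq0; rewrite [x / _]mulrC. Qed.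

(* The right tail, reflected: it satisfies the same hypotheses as [Phi]. *)
Let ccdf x := 1 - Phi (- x).
Let dccdf (x : R) : is_derive x 1 ccdf (phi x).
Proof.
have h := @is_derive1_comp _ Phi -%R x _ _ (dPhi (- x)) (is_deriveNid _ _).
have -> : ccdf = cst 1 - (Phi \o -%R) by [].
apply: is_derive_eq.
by rewrite mulrN1 normal_pdf_sym// sub0r opprK.
Qed.
Let ccdf0 x : 0 <= ccdf x.
Proof. by rewrite subr_ge0 normal_cdf_le1. Qed.
Let ccdfNy : ccdf x @[x --> -oo] --> (0 : R).
Proof.
have h : (fun x => 1 - Phi x) x @[x --> +oo] --> (1 - 1 : R).
  by apply: cvgB; [exact: cvg_cst|exact: normal_cdfy1].
rewrite subrr in h; apply/cvgNy_compNP.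
have -> // : ccdf \o -%R = (fun x => 1 - Phi x).
by apply/funext => x; rewrite /ccdf/= opprK.
Qed.

Lemma normal_mills_left x : x < 0 -> t * - x * Phi x <= phi x.
Proof.
exact: (mills_upper t0 phi0 dPhi dphi (normal_cdfNy0 s)).
Qed.

Lemma normal_mills_right x : 0 < x -> t * x * (1 - Phi x) <= phi x.
Proof.
move=> x0; have := mills_upper t0 phi0 dccdf dphi ccdfNy.
by move=> /(_ (- x)); rewrite oppr_lt0 normal_pdf_sym// /ccdf opprK; apply.
Qed.

Lemma normal_mills_second_left x : x <= -1 ->
  0 <= (1 + t * x ^+ 2) * Phi x / phi x + x <= s ^+ 2.
Proof.
move=> x1; rewrite -{3}[s ^+ 2]invrK.
exact: (mills_second t0 phi0 dPhi dphi (normal_cdf_ge0 s) (normal_cdfNy0 s)).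
Qed.

Lemma normal_mills_second_right x : 1 <= x ->
  0 <= (1 + t * x ^+ 2) * (1 - Phi x) / phi x - x <= s ^+ 2.
Proof.
move=> x1; rewrite -{3}[s ^+ 2]invrK.
have := mills_second t0 phi0 dccdf dphi ccdf0 ccdfNy.
by move=> /(_ (- x)); rewrite lerN2 normal_pdf_sym// /ccdf opprK sqrrN; apply.
Qed.

Lemma normal_cdf_mono x y : x < y -> Phi x < Phi y.
Proof.
move=> xy; have [z _ h] := mean_value (ltW xy) (fun z _ => dPhi z).
by rewrite -subr_gt0 h mulr_gt0// subr_gt0.
Qed.

Lemma normal_cdf_gt0 x : 0 < Phi x.
Proof.
by apply: le_lt_trans (normal_cdf_ge0 s (x - 1)) _; apply: normal_cdf_mono; rewrite gtrBl.
Qed.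

Lemma normal_cdf_lt1 x : Phi x < 1.
Proof.
by apply: lt_le_trans (normal_cdf_le1 s (x + 1)); apply: normal_cdf_mono; rewrite ltrDl.
Qed.

Section Solution.
Variables a b : R.
Hypotheses (a0 : 0 < a) (ab : a < b) (b1 : b < 1).
Let c := (a + b) / 2.
Let c01 : 0 <= c <= 1.
Proof. by move: a0 ab b1 => ? ? ?; rewrite /c; apply/andP; split; lra. Qed.
Let num x := ramp_prim a b (Phi x) - c * Phi x.

(** The solution of [f' - t * x * f = ramp a b (Phi x) - c] obtained from the
    integrating factor [phi]. *)
Definition stein_sol x := num x / phi x.
Definition stein_sol' x := ramp a b (Phi x) - c + t * x * stein_sol x.

Let dnum (x : R) : is_derive x 1 num (ramp a b (Phi x) * phi x - c * phi x).
Proof.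
have h := @is_derive1_comp _ (ramp_prim a b) Phi x _ _ (is_derive_ramp_prim _ ab) (dPhi x).
have := dPhi x => ?.
have -> : num = (ramp_prim a b \o Phi) - c *: Phi by [].
exact: is_derive_eq.
Qed.

Lemma is_derive_stein_sol (x : R) : is_derive x 1 stein_sol (stein_sol' x).
Proof.
have phix : phi x != 0 by rewrite gt_eqF.
have dq := is_derive_ratio phix (dnum x) (dphi x).
apply: is_derive_eq; rewrite /stein_sol' /stein_sol.
by field; rewrite s_neq0 phix.
Qed.

Let num_le x : `|num x| <= Phi x /\ `|num x| <= 1 - Phi x.
Proof. exact: ramp_prim_bound (normal_cdf_itv s x). Qed.

(** As [num x] is at most [Phi x] and at most [1 - Phi x], the first Mills
    inequality of the relevant side bounds [t * x * stein_sol x] by 1. *)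
Lemma stein_sol'_bounded x : `|stein_sol' x| <= 2.
Proof.
have [nl nr] := num_le x.
apply: le_trans (ler_normD _ _) _.
have h1 : `|ramp a b (Phi x) - c| <= 1.
  have /andP[r0 r1] := ramp_bound (Phi x) ab; have /andP[c0 c1] := c01.
  by rewrite ler_norml; apply/andP; split; lra.
suff h2 : `|t * x * stein_sol x| <= 1 by lra.
rewrite /stein_sol mulrA normrM normfV (gtr0_norm (phi0 _)) ler_pdivrMr// mul1r.
rewrite !normrM (gtr0_norm t0).
have [x0|x0|->] := ltgtP x 0.
- apply: le_trans (normal_mills_left x0).
  by rewrite (ltr0_norm x0) ler_wpM2l// mulr_ge0 ?oppr_ge0 ?(ltW t0) ?(ltW x0).
- apply: le_trans (normal_mills_right x0).
  by rewrite (gtr0_norm x0) ler_wpM2l// mulr_ge0 ?(ltW t0) ?(ltW x0).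
- by rewrite normr0 mulr0 mul0r ltW.
Qed.

(* Up to the factor [t], the derivative of the term [t * x * stein_sol x] of
   [stein_sol' x]. *)
Let Q x := (1 + t * x ^+ 2) * stein_sol x + x * (ramp a b (Phi x) - c).

Let dQ (x : R) : is_derive x 1 (fun x => t * x * stein_sol x) (t * Q x).
Proof.
have := is_derive_stein_sol x => ?.
have -> : (fun x => t * x * stein_sol x) = t *: (id * stein_sol).
  by apply/funext => y; rewrite -mulrA.
apply: is_derive_eq; rewrite /Q /stein_sol' /GRing.scale/=.
ring.
Qed.

Lemma quantile_bracket : exists2 M, 1 <= M & Phi (- M) <= a /\ b <= Phi M.
Proof.
have /(_ _)h1 := cvgr_le _ (normal_cdfNy0 s) _ a0.
have /(_ _)h2 := cvgr_ge _ (normal_cdfy1 s) _ b1.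
have [y [ya y1]] := @filter_ex _ _ _ _ (filterI h1 (nbhs_ninfty_le (num_real (-1)))).
have [z [bz z1]] := @filter_ex _ _ _ _ (filterI h2 (nbhs_pinfty_ge (num_real 1))).
have mono u v : u <= v -> Phi u <= Phi v.
  by rewrite le_eqVlt => /predU1P[->//|/normal_cdf_mono/ltW].
exists (Num.max (- y) z); first by rewrite le_max z1 orbT.
split; [apply: le_trans ya|apply: le_trans bz _]; apply: mono.
- by rewrite oppr_max opprK ge_min lexx.
- by rewrite le_max lexx orbT.
Qed.

(* Outside a compact interval the ramp is constant, [num] is a multiple of a
   tail of the normal law and the second order Mills bound applies; inside,
   [phi] is bounded away from 0. *)
Let Q_bounded : exists K, forall x, `|Q x| <= K.
Proof.
have [M M1 [Ma Mb]] := quantile_bracket.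
exists (s ^+ 2 + ((1 + t * M ^+ 2) / phi M + M)) => x.
have K1 : 0 <= (1 + t * M ^+ 2) / phi M + M.
  by rewrite addr_ge0 ?(le_trans _ M1)// divr_ge0 ?(ltW (phi0 _))// addr_ge0// mulr_ge0 ?sqr_ge0// ltW.
have tail d y : 0 <= d <= 1 -> 0 <= y <= s ^+ 2 -> `|d * y| <= s ^+ 2.
  move=> /andP[d0 d1] /andP[y0 ys]; rewrite normrM !ger0_norm//.
  by apply: le_trans ys; rewrite ler_piMl.
have [xM|Mx] := ltP x (- M).
  rewrite ler_wpDr//.
  have Phia : Phi x <= a by rewrite (le_trans _ Ma)// ltW// normal_cdf_mono.
  rewrite /Q /stein_sol /num ramp_left// ramp_prim_left//.
  have -> : (1 + t * x ^+ 2) * ((Phi x - c * Phi x) / phi x) + x * (1 - c) =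
    (1 - c) * ((1 + t * x ^+ 2) * Phi x / phi x + x) by ring.
  apply: tail; first by move: c01 => /andP[? ?]; apply/andP; split; lra.
  by apply: normal_mills_second_left; lra.
have [xM|xM] := ltP M x.
  rewrite ler_wpDr//.
  have Phib : b <= Phi x by rewrite (le_trans Mb)// ltW// normal_cdf_mono.
  rewrite /Q /stein_sol /num ramp_right// ramp_prim_right//.
  have -> : (1 + t * x ^+ 2) * ((c - c * Phi x) / phi x) + x * (0 - c) =
    c * ((1 + t * x ^+ 2) * (1 - Phi x) / phi x - x) by ring.
  by apply: tail => //; apply: normal_mills_second_right; lra.
have xM' : `|x| <= M by rewrite ler_norml Mx.
rewrite ler_wpDl ?sqr_ge0//.
apply: le_trans (ler_normD _ _) _; rewrite lerD//.
- rewrite normrM ger0_norm; last by rewrite addr_ge0// mulr_ge0 ?sqr_ge0// ltW.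
  apply: ler_pM => //; first by rewrite addr_ge0// mulr_ge0 ?sqr_ge0// ltW.
    rewrite lerD2l ler_wpM2l ?(ltW t0)//.
    by rewrite -(real_normK (num_real x)) lerXn2r// nnegrE (le_trans _ M1).
  rewrite /stein_sol normrM normfV (gtr0_norm (phi0 _)).
  rewrite ler_pdivrMr//; apply: le_trans (_ : 1 <= _).
    by have [h _] := num_le x; rewrite (le_trans h)// normal_cdf_le1.
  by rewrite mulrC ler_pdivlMr// mul1r normal_pdf_anti.
- rewrite normrM -[leRHS]mulr1 ler_pM//.
  have /andP[r0 r1] := ramp_bound (Phi x) ab.
  by move: c01 => /andP[? ?]; rewrite ler_norml; apply/andP; split; lra.
Qed.

Lemma stein_sol'_lipschitz : exists K, forall x y,
  `|stein_sol' x - stein_sol' y| <= K * `|x - y|.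
Proof.
have [K QK] := Q_bounded.
exists (2 / (b - a) * normal_peak s + t * K) => x y.
have -> : stein_sol' x - stein_sol' y = (ramp a b (Phi x) - ramp a b (Phi y))
  + (t * x * stein_sol x - t * y * stein_sol y) by rewrite /stein_sol'; ring.
apply: le_trans (ler_normD _ _) _; rewrite mulrDl lerD//.
- apply: le_trans (ramp_lipschitz _ _ ab) _.
  rewrite -[leRHS]mulrA ler_wpM2l ?divr_ge0 ?subr_ge0 ?(ltW ab)//.
  apply: (bounded_derive_lipschitz dPhi) => z.
  by rewrite gtr0_norm// normal_pdf_ub.
- apply: (bounded_derive_lipschitz dQ) => z.
  by rewrite normrM (gtr0_norm t0) ler_wpM2l// ltW.
Qed.

Lemma stein_equation x :
  stein_sol' x - t * x * stein_sol x = ramp a b (Phi x) - (a + b) / 2.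
Proof. by rewrite /stein_sol' addrK. Qed.

End Solution.
End NormalMills.

(** * Expectations on a finite probability space *)

Section FiniteExpectation.
Context {R : realType} {W : finType}.
Variable q : W -> R.
Hypothesis q0 : forall w, 0 <= q w.
Hypothesis q1 : \sum_w q w = 1.
Implicit Types F G : W -> R.

Definition fin_expect F : R := \sum_w q w * F w.

Lemma eq_fin_expect F G : (forall w, F w = G w) -> fin_expect F = fin_expect G.
Proof. by move=> FG; apply: eq_bigr => w _; rewrite FG. Qed.

Lemma fin_expectD F G : fin_expect (fun w => F w + G w) = fin_expect F + fin_expect G.
Proof. by rewrite -big_split; apply: eq_bigr => w _; rewrite mulrDr. Qed.

Lemma fin_expectZ k F : fin_expect (fun w => k * F w) = k * fin_expect F.
Proof. by rewrite mulr_sumr; apply: eq_bigr => w _; rewrite mulrCA. Qed.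

Lemma fin_expectB F G : fin_expect (fun w => F w - G w) = fin_expect F - fin_expect G.
Proof. by rewrite -sumrB; apply: eq_bigr => w _; rewrite mulrBr. Qed.

Lemma fin_expect_cst k : fin_expect (fun=> k) = k.
Proof. by rewrite /fin_expect -mulr_suml q1 mul1r. Qed.

Lemma fin_expect_sum (I : finType) (P : pred I) (F : I -> W -> R) :
  fin_expect (fun w => \sum_(i | P i) F i w) = \sum_(i | P i) fin_expect (F i).
Proof.
rewrite /fin_expect exchange_big; apply: eq_bigr => w _; exact: mulr_sumr.
Qed.

Lemma le_fin_expect F G : (forall w, F w <= G w) -> fin_expect F <= fin_expect G.
Proof. by move=> FG; apply: ler_sum => w _; rewrite ler_wpM2l. Qed.

Lemma fin_expect_ge0 F : (forall w, 0 <= F w) -> 0 <= fin_expect F.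
Proof. by move=> F0; apply: sumr_ge0 => w _; rewrite mulr_ge0. Qed.

Lemma ler_norm_fin_expect F : `|fin_expect F| <= fin_expect (fun w => `|F w|).
Proof.
apply: le_trans (ler_norm_sum _ _ _) _; apply: ler_sum => w _.
by rewrite normrM ger0_norm.
Qed.

Lemma fin_expect_bounded F k : (forall w, `|F w| <= k) -> `|fin_expect F| <= k.
Proof.
move=> Fk; apply: le_trans (ler_norm_fin_expect _) _.
by rewrite -[leRHS]fin_expect_cst le_fin_expect.
Qed.

(** The inequality [`|x| <= r^-1 + r * x ^+ 2] integrated; with [r] of the right
    order it replaces the Cauchy-Schwarz inequality. *)
Lemma fin_expect_norm_le_sqr F r : 0 < r ->
  fin_expect (fun w => `|F w|) <= r^-1 + r * fin_expect (fun w => F w ^+ 2).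
Proof.
move=> r0; rewrite -(fin_expect_cst r^-1) -fin_expectZ -fin_expectD; apply: le_fin_expect => w.
rewrite -(real_normK (num_real (F w))); set x := `|F w|.
have x0 : 0 <= x by exact: normr_ge0.
have h : 0 <= r * (x - r^-1) ^+ 2 by rewrite mulr_ge0 ?sqr_ge0 ?ltW.
suff : r * (x - r^-1) ^+ 2 = r * x ^+ 2 - 2 * x + r^-1 by lra.
by field; rewrite gt_eqF.
Qed.

(** In the expansion of the square only the linked pairs contribute, each by at
    most [k ^+ 2]. *)
Lemma fin_expect_sqr_local_sum (U : finType) (A : {set U}) (lk : rel U)
    (Z : U -> W -> R) (k : R) (d : nat) :
  (forall u w, u \in A -> `|Z u w| <= k) ->
  (forall u v, u \in A -> v \in A -> ~~ lk u v -> fin_expect (fun w => Z u w * Z v w) = 0) ->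
  (forall u, u \in A -> (#|[set v in A | lk u v]| <= d)%N) ->
  fin_expect (fun w => (\sum_(u in A) Z u w) ^+ 2) <= k ^+ 2 * (#|A| * d)%:R.
Proof.
move=> Zk Z0 lkd.
have -> : fin_expect (fun w => (\sum_(u in A) Z u w) ^+ 2) =
    \sum_(u in A) \sum_(v in A) fin_expect (fun w => Z u w * Z v w).
  rewrite -(eq_bigr _ (fun u _ => fin_expect_sum _ _)) -fin_expect_sum; apply: eq_fin_expect => w.
  by rewrite expr2 mulr_suml; apply: eq_bigr => u _; rewrite mulr_sumr.
have -> : k ^+ 2 * (#|A| * d)%:R = \sum_(u in A) k ^+ 2 * d%:R.
  by rewrite sumr_const -[RHS]mulr_natr natrM; ring.
apply: ler_sum => u uA.
rewrite (bigID (fun v => lk u v))/= [X in _ + X]big1 ?addr0; last first.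
  by move=> v /andP[vA nuv]; exact: Z0.
apply: le_trans (_ : \sum_(v in A | lk u v) k ^+ 2 <= _).
  apply: ler_sum => v /andP[vA _]; apply: le_trans (ler_norm _) _.
  apply: fin_expect_bounded => w; rewrite normrM expr2 ler_pM//; exact: Zk.
rewrite sumr_const -[leLHS]mulr_natr ler_wpM2l ?sqr_ge0// ler_nat.
by apply: leq_trans (lkd u uA); rewrite cardsE.
Qed.

End FiniteExpectation.

(** * Stein's method for sums with local dependence *)

Section LocalDependence.
Context {R : realType} {I : finType}.
Implicit Types (A B E F : {set I}) (G H : {set I} -> R).

(** [G] is measurable for the sigma-algebra generated by the events
    [e \in A], [e] ranging over [E]. *)
Definition determined_by E G :=
  forall A B, (forall e, e \in E -> (e \in A) = (e \in B)) -> G A = G B.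

Variable q : {set I} -> R.
Hypothesis q0 : forall A, 0 <= q A.
Hypothesis q1 : \sum_A q A = 1.
Variable adj : rel I.
Hypothesis adj_sym : symmetric adj.
Hypothesis indep : forall E F,
  (forall e f, e \in E -> f \in F -> ~~ adj e f) ->
  forall G H, determined_by E G -> determined_by F H ->
  fin_expect q (fun A => G A * H A) = fin_expect q G * fin_expect q H.

Variables (J : {set I}) (D : nat).
Let nb e := [set f in J | adj e f].
Hypothesis degD : forall e, e \in J -> (#|nb e| <= D)%N.

Variable Y : I -> {set I} -> R.
Hypothesis Yloc : forall e, determined_by [set e] (Y e).
Hypothesis Y1 : forall e A, `|Y e A| <= 1.
Hypothesis Y0 : forall e, e \in J -> fin_expect q (Y e) = 0.

Variable c : R.
Hypothesis c0 : 0 <= c.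
(* [Wfar e] drops the neighbours of [e] from [W]; it is independent of [Y e]. *)
Let W A := c * \sum_(e in J) Y e A.
Let Wfar e A := c * \sum_(f in J | ~~ adj e f) Y f A.
Let v := fin_expect q (fun A => W A ^+ 2).
Let S A := c ^+ 2 * \sum_(e in J) \sum_(f in nb e) Y e A * Y f A.

Let WB e A : W A - Wfar e A = c * \sum_(f in nb e) Y f A.
Proof.
rewrite /W (bigID (adj e))/= mulrDr addrK; congr (_ * _).
by apply: eq_bigl => f; rewrite inE.
Qed.

Let W_near e A : e \in J -> `|W A - Wfar e A| <= c * D%:R.
Proof.
move=> eJ; rewrite WB normrM ger0_norm// ler_wpM2l//.
apply: le_trans (ler_norm_sum _ _ _) _.
apply: le_trans (_ : \sum_(f in nb e) 1 <= _); first by apply: ler_sum.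
by rewrite sumr_const ler_nat degD.
Qed.

Let far_orthogonal e h : e \in J -> fin_expect q (fun A => Y e A * h (Wfar e A)) = 0.
Proof.
move=> eJ.
rewrite (@indep [set e] [set f in J | ~~ adj e f] _ (Y e) (fun A => h (Wfar e A)))//.
- by rewrite Y0// mul0r.
- by move=> e' f /set1P -> ; rewrite inE => /andP[].
- move=> A B AB; rewrite /Wfar; congr (h (_ * _)); apply: eq_bigr => f fJ.
  by apply: Yloc => g /set1P ->; apply: AB; rewrite inE.
Qed.

Let pair_orthogonal e f : e \in J -> ~~ adj e f ->
  fin_expect q (fun A => Y e A * Y f A) = 0.
Proof.
move=> eJ ef; rewrite (@indep [set e] [set f] _ (Y e) (Y f))//.
- by rewrite Y0// mul0r.
- by move=> e' f' /set1P -> /set1P ->.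
Qed.

Let expectation_S : fin_expect q S = v.
Proof.
rewrite /S fin_expectZ /v (@eq_fin_expect _ _ _ (fun A => W A ^+ 2)
  (fun A => c ^+ 2 * \sum_(e in J) \sum_(f in J) Y e A * Y f A)); last first.
  move=> A; rewrite /W exprMn; congr (_ * _).
  by rewrite expr2 mulr_suml; apply: eq_bigr => u _; rewrite mulr_sumr.
rewrite fin_expectZ; congr (_ * _); rewrite !fin_expect_sum; apply: eq_bigr => e eJ.
rewrite !fin_expect_sum [in RHS](bigID (adj e))/= [X in _ = _ + X]big1 ?addr0.
  by apply: eq_bigl => f; rewrite inE.
by move=> f /andP[fJ ef]; exact: pair_orthogonal.
Qed.

(* [S] is a sum over pairs of adjacent indices.  Two such pairs with no adjacency
   between them give independent products, so [S] is itself a sum with local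
   dependence. *)
Let pairs := [set u : I * I | (u.1 \in J) && (u.2 \in nb u.1)].
Let linked (u u' : I * I) :=
  [|| adj u.1 u'.1, adj u.1 u'.2, adj u.2 u'.1 | adj u.2 u'.2].

Let card_pairs (A : {set I}) : A \subset J ->
  (#|[set u : I * I | (u.1 \in A) && (u.2 \in nb u.1)]| <= #|A| * D)%N.
Proof.
move=> /fintype.subsetP AJ; rewrite -[X in (X <= _)%N]sum1_card.
under eq_bigl => u do rewrite inE.
rewrite -(pair_big_dep (mem A) (fun e f => f \in nb e) (fun _ _ => 1%N))/=.
rewrite -sum_nat_const; apply: leq_sum => e eA.
by rewrite sum1_card degD// AJ.
Qed.

Let card_fst e : e \in J -> (#|[set u in pairs | adj e u.1]| <= D * D)%N.
Proof.
move=> eJ; apply: leq_trans (_ : #|nb e| * D <= _)%N; last first.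
  by rewrite leq_mul2r degD// orbT.
apply: leq_trans (card_pairs _); last first.
  by apply/fintype.subsetP => f; rewrite inE => /andP[].
apply: subset_leq_card; apply/fintype.subsetP => u; rewrite !inE.
by move=> /andP[/andP[-> ->] ->].
Qed.

(* Exchanging the two indices of a pair reduces this to the previous count. *)
Let card_snd e : e \in J -> (#|[set u in pairs | adj e u.2]| <= D * D)%N.
Proof.
move=> eJ; apply: leq_trans (card_fst eJ).
pose sw (u : I * I) := (u.2, u.1).
rewrite -(@card_imset _ _ sw); last by move=> [? ?] [? ?] [-> ->].
apply: subset_leq_card; apply/fintype.subsetP => _ /imsetP[u + ->].
by rewrite !inE/= => /andP[/and3P[-> -> a1] ->]; rewrite adj_sym a1.
Qed.

Let card_linked u : u \in pairs -> (#|[set u' in pairs | linked u u']| <= 4 * (D * D))%N.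
Proof.
rewrite !inE => /and3P[u1 u2 _].
have -> : [set u' in pairs | linked u u'] =
    ([set u' in pairs | adj u.1 u'.1] :|: [set u' in pairs | adj u.1 u'.2]) :|:
    ([set u' in pairs | adj u.2 u'.1] :|: [set u' in pairs | adj u.2 u'.2]).
  by apply/setP => u'; rewrite !inE /linked -!andb_orr !orbA.
apply: leq_trans (leq_card_setU _ _) _.
rewrite (_ : 4 * (D * D) = (D * D + D * D) + (D * D + D * D))%N; last first.
  by rewrite !mulSn mul0n addn0 !addnA.
by rewrite leq_add// (leq_trans (leq_card_setU _ _))// leq_add// ?card_fst ?card_snd.
Qed.

Let variance_S :
  fin_expect q (fun A => (S A - v) ^+ 2) <= c ^+ 4 * (16 * (#|J| * D ^ 3))%:R.
Proof.
pose m u := fin_expect q (fun A => Y u.1 A * Y u.2 A).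
pose Z (u : I * I) A := Y u.1 A * Y u.2 A - m u.
have SE A : S A = c ^+ 2 * \sum_(u in pairs) Y u.1 A * Y u.2 A.
  rewrite /S; congr (_ * _).
  rewrite (pair_big_dep (mem J) (fun e f => f \in nb e) (fun e f => Y e A * Y f A))/=.
  by apply: eq_bigl => u; rewrite [in RHS]inE.
have vE : v = c ^+ 2 * \sum_(u in pairs) m u.
  by rewrite -expectation_S (eq_fin_expect _ SE) fin_expectZ fin_expect_sum.
have -> : fin_expect q (fun A => (S A - v) ^+ 2) =
    c ^+ 4 * fin_expect q (fun A => (\sum_(u in pairs) Z u A) ^+ 2).
  rewrite -fin_expectZ; apply: eq_fin_expect => A.
  by rewrite SE vE -mulrBr -sumrB exprMn -exprM.
rewrite ler_wpM2l ?exprn_ge0//.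
have YY u A : `|Y u.1 A * Y u.2 A| <= 1.
  by rewrite normrM -[leRHS]mulr1 ler_pM.
apply: le_trans (@fin_expect_sqr_local_sum _ _ _ q0 q1 _ pairs linked Z 2 (4 * (D * D)) _ _ _) _.
- move=> u A _; apply: le_trans (ler_normB _ _) _.
  have := YY u A; have : `|m u| <= 1 by apply: fin_expect_bounded.
  lra.
- move=> u u' up u'p; rewrite /linked !negb_or => /and4P[l1 l2 l3 l4].
  have loc (w : I * I) : determined_by [set w.1; w.2]%SET (Z w).
    move=> A B AB; rewrite /Z; congr (_ * _ - _); apply: Yloc => e /set1P ->; apply: AB;
    by rewrite !inE eqxx ?orbT.
  rewrite (@indep [set u.1; u.2]%SET [set u'.1; u'.2]%SET _ (Z u) (Z u'))//.
    by rewrite {1}/Z fin_expectB fin_expect_cst// subrr mul0r.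
  by move=> e f /set2P[->|->] /set2P[->|->].
- exact: card_linked.
- have -> : (2 : R) ^+ 2 = 4%:R by ring.
  rewrite -natrM ler_nat; apply: leq_trans (_ : 4 * ((#|J| * D) * (4 * (D * D))) <= _)%N.
    by rewrite leq_mul2l/= leq_mul2r card_pairs// orbT.
  by rewrite !expnS expn0; lia.
Qed.

(** In [W * f W = c * \sum_e Y e * f W], expand [f W] at [Wfar e].  The zeroth
    order term has mean 0 by independence; the first order terms add up to
    [S * f' W], and [S] is close to its mean [v]; the remainder is quadratic in
    [W - Wfar e], which is at most [c * D]. *)
Theorem stein_local_dependence (f f' : R -> R) (K1 K2 r : R) :
  (forall x : R, is_derive x 1 f (f' x)) ->
  (forall x, `|f' x| <= K1) ->
  (forall x y, `|f' x - f' y| <= K2 * `|x - y|) ->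
  0 < r ->
  `|fin_expect q (fun A => W A * f (W A)) - v * fin_expect q (fun A => f' (W A))| <=
    K1 * (r^-1 + r * (c ^+ 4 * (16 * (#|J| * D ^ 3))%:R))
    + K2 * (c ^+ 3 * (#|J| * D ^ 2)%:R).
Proof.
move=> df f'K1 f'K2 r0.
have K10 : 0 <= K1 by exact: le_trans (normr_ge0 _) (f'K1 0).
have K20 : 0 <= K2.
  by have := le_trans (normr_ge0 _) (f'K2 1 0); rewrite subr0 normr1 mulr1.
pose rem e A := f (W A) - f (Wfar e A) - f' (W A) * (W A - Wfar e A).
have remK e A : e \in J -> `|rem e A| <= K2 * (c * D%:R) ^+ 2.
  move=> eJ; apply: le_trans (taylor_lipschitz df f'K2 _ _) _.
  rewrite ler_wpM2l// -(real_normK (num_real _)) lerXn2r ?nnegrE ?mulr_ge0//.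
  exact: W_near.
pose T A := c * \sum_(e in J) Y e A * rem e A.
have SE A : S A = c * \sum_(e in J) Y e A * (W A - Wfar e A).
  rewrite /S expr2 -mulrA; congr (_ * _); rewrite mulr_sumr; apply: eq_bigr => e _.
  by rewrite WB mulrCA -[in LHS]mulr_sumr.
have decomp A : W A * f (W A) =
    c * (\sum_(e in J) Y e A * f (Wfar e A)) + (S A * f' (W A) + T A).
  rewrite /T SE {1}/W -!mulrA -!mulrDr; congr (_ * _).
  rewrite !mulr_suml -!big_split; apply: eq_bigr => e _ /=.
  by rewrite /rem; ring.
have -> : fin_expect q (fun A => W A * f (W A)) - v * fin_expect q (fun A => f' (W A)) =
    fin_expect q (fun A => (S A - v) * f' (W A)) + fin_expect q T.
  rewrite (eq_fin_expect _ decomp) fin_expectD fin_expectZ fin_expect_sum big1 ?mulr0 ?add0r; last first.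
    by move=> e eJ; exact: far_orthogonal.
  rewrite fin_expectD addrAC -fin_expectZ -fin_expectB; congr (_ + _).
  by apply: eq_fin_expect => A; rewrite mulrBl.
apply: le_trans (ler_normD _ _) _; apply: lerD.
- apply: le_trans (ler_norm_fin_expect q0 _) _.
  apply: le_trans (_ : fin_expect q (fun A => K1 * `|S A - v|) <= _).
    by apply: le_fin_expect => // A; rewrite normrM mulrC ler_wpM2r.
  rewrite fin_expectZ ler_wpM2l//.
  apply: le_trans (fin_expect_norm_le_sqr q0 q1 _ r0) _.
  by rewrite lerD2l ler_wpM2l ?(ltW r0)//; exact: variance_S.
- apply: fin_expect_bounded => // A; rewrite /T normrM ger0_norm//.
  have -> : K2 * (c ^+ 3 * (#|J| * D ^ 2)%:R) = c * \sum_(e in J) K2 * (c * D%:R) ^+ 2.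
    by rewrite sumr_const -[in RHS]mulr_natr natrM natrX; ring.
  rewrite ler_wpM2l//; apply: le_trans (ler_norm_sum _ _ _) _.
  apply: ler_sum => e eJ; rewrite normrM -[leRHS]mul1r ler_pM//.
  exact: remK.
Qed.
End LocalDependence.

(** * The law of the arc set of a random digraph *)

Section ArcLaw.
Context {d} {T : measurableType d} {R : realType} {n : nat}.
Variables (P : probability T R) (D : random_digraph T n).
Local Notation arc := ('I_n * 'I_n)%type.
Implicit Types (A E F : {set arc}).

Lemma measurable_arcs (Q : pred {set arc}) :
  measurable [set w | Q (arcs (D w))]%classic.
Proof. exact: (measurable_rdigraph D [set G | Q (arcs G)]%classic). Qed.

Definition arc_law A : R := fine (P [set w | arcs (D w) == A]%classic).

Lemma arc_law_ge0 A : 0 <= arc_law A.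
Proof. by rewrite fine_ge0. Qed.

Lemma expectation_arcs (F : {set arc} -> R) :
  'E_P[fun w => F (arcs (D w))]%E = (fin_expect arc_law F)%:E.
Proof.
pose ev A : set T := [set w | arcs (D w) == A]%classic.
have mev A : measurable (ev A) by exact: (measurable_arcs (pred1 A)).
have FE w : (F (arcs (D w)))%:E = (\sum_A (F A)%:E * (\1_(ev A) w)%:E)%E.
  rewrite (bigD1 (arcs (D w)))//= big1 ?adde0.
    by rewrite indicE mem_set ?mule1//; exact/eqxx.
  move=> A AD; rewrite indicE memNset ?mule0// => /eqP DA.
  by rewrite DA eqxx in AD.
rewrite unlock (eq_integral _ _ (fun w _ => FE w)) integral_sum//; last first.
  by move=> A; apply: integrableZl => //; exact: integrable_indic.
rewrite -sumEFin; apply: eq_bigr => A _.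
rewrite integralZl//; last exact: integrable_indic.
rewrite integral_indic// setIT /arc_law EFinM fineK 1?muleC//.
by apply: fin_num_measure; exact: mev.
Qed.

Lemma arc_law_sum : \sum_A arc_law A = 1.
Proof.
have := expectation_arcs (fun=> 1); rewrite expectation_cst => -[->].
by rewrite /fin_expect; apply: eq_bigr => A _; rewrite mulr1.
Qed.

Lemma probability_arcs (Q : pred {set arc}) :
  P [set w | Q (arcs (D w))]%classic = (fin_expect arc_law (fun A => (Q A)%:R))%:E.
Proof.
rewrite -expectation_arcs -expectation_indic; last exact: measurable_arcs.
congr expectation; apply/funext => w.
by rewrite indicE; congr (nat_of_bool _)%:R; apply/idP/idP; rewrite inE.
Qed.

Definition nonloops : {set arc} := [set e | e.1 != e.2].

(** Between pairs of distinct vertices, this relation says that they have a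
    vertex in common. *)
Definition arc_adj : rel arc := fun e f => ~~ vertex_disjoint e f.

Lemma arcs_nonloops w : arcs (D w) \subset nonloops.
Proof.
apply/fintype.subsetP => -[i j] ij; rewrite inE; apply: contraTneq ij => /= ->.
exact: arcs_loopless.
Qed.

Lemma arc_indE e w : arc_ind R D e.1 e.2 w = (e \in arcs (D w))%:R.
Proof.
case: e => i j; rewrite /arc_ind indicE; congr (nat_of_bool _)%:R.
by apply/idP/idP; rewrite inE.
Qed.

Lemma cylinderE E (S : {set arc}) : S \subset E ->
  [set w | arcs (D w) :&: E == S]%classic =
  (\bigcap_(e in [set` E]) (arc_ind R D e.1 e.2 @^-1` [set (e \in S)%:R]))%classic.
Proof.
move=> /fintype.subsetP SE; apply/seteqP; split => w /=.
- move=> /eqP AS e eE /=; rewrite arc_indE -AS inE.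
  by rewrite (eqP (introT eqP eE))/= andbT.
- move=> H; apply/eqP/setP => e; rewrite inE.
  have [eE|eE] := boolP (e \in E); last by rewrite andbF; apply/esym/negbTE; apply: contra eE; exact: SE.
  have /= := H e eE; rewrite arc_indE andbT => /eqP.
  by rewrite eqr_nat; case: (e \in _); case: (e \in S).
Qed.

Hypothesis indep : disjoint_arcs_independent P D.

Lemma independent_cylinders E F (S S' : {set arc}) :
  (forall e f, e \in E -> f \in F -> ~~ arc_adj e f) ->
  S \subset E -> S' \subset F ->
  fin_expect arc_law (fun A => (A :&: E == S)%:R * (A :&: F == S')%:R) =
  fin_expect arc_law (fun A => (A :&: E == S)%:R) *
  fin_expect arc_law (fun A => (A :&: F == S')%:R).
Proof.
move=> EF SE SF.
have EF' e f : e \in E -> f \in F -> vertex_disjoint e f.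
  by move=> eE fF; have := EF e f eE fF; rewrite negbK.
have := indep EF' (A := fun e => [set (e \in S)%:R]%classic)
  (B := fun e => [set (e \in S')%:R]%classic)
  (fun e => measurable_set1 _) (fun e => measurable_set1 _).
rewrite /= -!cylinderE//.
have -> : ([set w | arcs (D w) :&: E == S] `&` [set w | arcs (D w) :&: F == S'] =
    [set w | (arcs (D w) :&: E == S) && (arcs (D w) :&: F == S')])%classic.
  by apply/seteqP; split => w /= => [[-> ->]|/andP[]].
rewrite (probability_arcs (fun A => (A :&: E == S) && (A :&: F == S'))).
rewrite (probability_arcs (fun A => A :&: E == S)) (probability_arcs (fun A => A :&: F == S')).
rewrite -EFinM => -[<-]; apply: eq_fin_expect => A.
by rewrite -natrM mulnb.
Qed.

(** A functional determined by [E] is a combination of indicators of the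
    cylinders [A :&: E == S], on which independence is the hypothesis. *)
Lemma arc_law_independent E F :
  (forall e f, e \in E -> f \in F -> ~~ arc_adj e f) ->
  forall G H : {set arc} -> R, determined_by E G -> determined_by F H ->
  fin_expect arc_law (fun A => G A * H A) = fin_expect arc_law G * fin_expect arc_law H.
Proof.
move=> EF G H EG FH.
have split_ K (L : {set arc} -> R) : determined_by K L ->
    forall A, L A = \sum_(S : {set arc} | S \subset K) L S * (A :&: K == S)%:R.
  move=> KL A; rewrite (bigD1 (A :&: K)) ?subsetIr//= eqxx mulr1.
  rewrite big1 ?addr0; first by apply: KL => e eK; rewrite inE eK andbT.
  by move=> S /andP[_ /negbTE]; rewrite eq_sym => ->; rewrite mulr0.
rewrite (eq_fin_expect _ (split_ _ _ EG)) (eq_fin_expect _ (split_ _ _ FH)) !fin_expect_sum.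
have -> : fin_expect arc_law (fun A => G A * H A) = fin_expect arc_law
  (fun A => \sum_(S : {set arc} | S \subset E) \sum_(S' : {set arc} | S' \subset F)
   (G S * H S') * ((A :&: E == S)%:R * (A :&: F == S')%:R)).
  apply: eq_fin_expect => A; rewrite (split_ _ _ EG) (split_ _ _ FH) mulr_suml.
  by apply: eq_bigr => S _; rewrite mulr_sumr; apply: eq_bigr => S' _; ring.
rewrite fin_expect_sum mulr_suml; apply: eq_bigr => S SE.
rewrite fin_expect_sum mulr_sumr; apply: eq_bigr => S' SF.
by rewrite !fin_expectZ independent_cylinders//; ring.
Qed.

End ArcLaw.
Arguments nonloops n : clear implicits.

(** * Counting arcs *)

Section ArcCounts.
Variable n : nat.
Local Notation arc := ('I_n * 'I_n)%type.

Lemma arc_adj_sym : symmetric (@arc_adj n).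
Proof.
move=> e f; rewrite /arc_adj /vertex_disjoint; congr (~~ _).
rewrite -[[:: e.1; _; _; _]]/([:: e.1; e.2] ++ [:: f.1; f.2]).
rewrite -[[:: f.1; _; _; _]]/([:: f.1; f.2] ++ [:: e.1; e.2]).
by rewrite uniq_catC.
Qed.

Lemma card_nonloops_le : (#|nonloops n| <= n ^ 2)%N.
Proof.
by apply: leq_trans (max_card _) _; rewrite card_prod card_ord expnS expn1.
Qed.

Lemma card_arc_adj e : e \in nonloops n ->
  (#|[set f in nonloops n | arc_adj e f]| <= 4 * n)%N.
Proof.
rewrite inE => e12.
(* A neighbour of [e] has an endpoint of [e] as its source or as its target. *)
pose src x := [set f : arc | f.1 == x]; pose tgt x := [set f : arc | f.2 == x].
have csrc x : (#|src x| <= n)%N.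
  rewrite -[leqRHS]card_ord -(card_in_imset (f := snd) (D := src x)) ?max_card//.
  by move=> [a b] [a' b']; rewrite !inE/= => /eqP -> /eqP -> ->.
have ctgt x : (#|tgt x| <= n)%N.
  rewrite -[leqRHS]card_ord -(card_in_imset (f := fst) (D := tgt x)) ?max_card//.
  by move=> [a b] [a' b']; rewrite !inE/= => /eqP -> /eqP -> ->.
apply: leq_trans (_ : #|(src e.1 :|: src e.2) :|: (tgt e.1 :|: tgt e.2)| <= _)%N.
  apply: subset_leq_card; apply/fintype.subsetP => f; rewrite !inE.
  move=> /andP[f12]; rewrite /arc_adj /vertex_disjoint /= !inE !negb_and !negb_or.
  rewrite (negbTE f12) e12 (eq_sym e.1 f.1) (eq_sym e.1 f.2) (eq_sym e.2 f.1) (eq_sym e.2 f.2).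
  by do 4 case: (_ == _).
rewrite (_ : 4 * n = (n + n) + (n + n))%N; last by lia.
by rewrite (leq_trans (leq_card_setU _ _))// leq_add// (leq_trans (leq_card_setU _ _))// leq_add.
Qed.

Lemma card_nonloops : #|nonloops n| = (n * (n - 1))%N.
Proof.
have -> : nonloops n = ~: [set (i, i) | i : 'I_n].
  apply/setP => -[i j]; rewrite !inE/=; congr (~~ _).
  apply/eqP/imsetP => [->|[k _ [-> ->]]//]; by exists j.
have := cardsC [set (i, i) | i : 'I_n].
rewrite card_imset; last by move=> i j [].
by rewrite card_prod !card_ord mulnBr muln1 => <-; rewrite addKn.
Qed.

End ArcCounts.

(** * The normalised arc density *)

Section Standardized.
Context {d} {T : measurableType d} {R : realType} {n : nat}.
Variables (P : probability T R) (D : random_digraph T n) (p : R).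
Hypothesis n1 : (1 < n)%N.
Hypothesis arcp : forall i j : 'I_n, i != j -> arc_prob P D i j = p%:E.
Local Notation arc := ('I_n * 'I_n)%type.
Local Notation q := (arc_law P D).

Definition arc_dev (e : arc) (A : {set arc}) : R := (e \in A)%:R - p.

Definition arc_scale : R := Num.sqrt n%:R / (n * (n - 1))%:R.

Definition arc_sum (A : {set arc}) : R :=
  arc_scale * \sum_(e in nonloops n) arc_dev e A.

Lemma fin_expect_arc e : e \in nonloops n -> fin_expect q (fun A => (e \in A)%:R) = p.
Proof.
rewrite inE => e12; apply/EFin_inj.
rewrite -(arcp e12) -(probability_arcs P D (fun A => e \in A)).
by rewrite /arc_prob /arc_event -surjective_pairing.
Qed.

Lemma arc_prob_itv : 0 <= p <= 1.
Proof.
have n0 : (0 < n)%N by exact: ltn_trans n1.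
have := arcp (i := Ordinal n0) (j := Ordinal n1) isT.
move=> pE; rewrite -!lee_fin -pE; rewrite probability_le1 ?andbT//.
exact: (measurable_arcs D (fun A => (_, _) \in A)).
Qed.

Lemma arc_dev_bounded e A : `|arc_dev e A| <= 1.
Proof.
have /andP[p0 p1] := arc_prob_itv.
by rewrite /arc_dev ler_norml; case: (e \in A); rewrite ?mulr1n ?mulr0n; apply/andP; split; lra.
Qed.

Lemma arc_dev_centred e : e \in nonloops n -> fin_expect q (arc_dev e) = 0.
Proof.
by move=> eJ; rewrite fin_expectB fin_expect_arc// fin_expect_cst ?subrr//; exact: arc_law_sum.
Qed.

Lemma arc_dev_local e : determined_by [set e] (arc_dev e).
Proof. by move=> A B AB; rewrite /arc_dev AB// set11. Qed.

Lemma arc_densityE w :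
  arc_density R D w = (n * (n - 1))%:R^-1 * \sum_(e in nonloops n) (e \in arcs (D w))%:R.
Proof.
rewrite /arc_density mulrC; congr (_ * _).
rewrite -natr_sum -sum1_card; congr (_%:R).
rewrite [RHS](big_setID (arcs (D w)))/= (finset.setIidPr (arcs_nonloops D w)).
rewrite [X in (_ + X)%N]big1 ?addn0; last first.
  by move=> e; rewrite inE => /andP[/negbTE ->].
by apply: eq_bigr => e ->.
Qed.

Let n_pos : (0 : R) < (n * (n - 1))%:R.
Proof. by rewrite ltr0n muln_gt0 subn_gt0 n1 (ltn_trans _ n1). Qed.

Lemma arc_sumE w :
  Num.sqrt n%:R * (arc_density R D w - p) = arc_sum (arcs (D w)).
Proof.
rewrite /arc_sum /arc_scale -mulrA; congr (_ * _).
rewrite /arc_dev sumrB mulrBr -arc_densityE; congr (_ - _).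
by rewrite sumr_const card_nonloops -[p *+ _]mulr_natr mulrCA mulVf ?mulr1// gt_eqF.
Qed.

Lemma expectation_arc_density : 'E_P[arc_density R D]%E = p%:E.
Proof.
pose F (A : {set arc}) : R := (n * (n - 1))%:R^-1 * \sum_(e in nonloops n) (e \in A)%:R.
have -> : arc_density R D = (fun w => F (arcs (D w))).
  by apply/funext => w; rewrite arc_densityE.
rewrite expectation_arcs /F fin_expectZ fin_expect_sum; congr EFin.
rewrite (eq_bigr (fun=> p)); last exact: fin_expect_arc.
by rewrite sumr_const card_nonloops -[p *+ _]mulr_natr mulrCA mulVf ?mulr1// gt_eqF.
Qed.

Lemma variance_arc_density :
  (n%:R%:E * 'V_P[arc_density R D])%E = (fin_expect q (fun A => arc_sum A ^+ 2))%:E.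
Proof.
rewrite /variance unlock expectation_arc_density/=.
pose F (A : {set arc}) : R := (n%:R)^-1 * arc_sum A ^+ 2.
have n0 : n%:R != 0 :> R by rewrite pnatr_eq0 -lt0n (ltn_trans _ n1).
rewrite (_ : _ * _ = (fun w => F (arcs (D w)))).
  by rewrite expectation_arcs /F fin_expectZ -EFinM mulrA mulfV// mul1r.
apply/funext => w; rewrite /F -arc_sumE exprMn sqr_sqrtr// mulrA mulVf// mul1r.
by rewrite expr2.
Qed.

Hypothesis indep : disjoint_arcs_independent P D.

Lemma arc_scale_bound : 0 <= arc_scale /\ arc_scale <= 2 / Num.sqrt n%:R ^+ 3.
Proof.
set s := Num.sqrt n%:R.
have s0 : 0 < s by rewrite sqrtr_gt0 ltr0n (ltn_trans _ n1).
have s2 : s ^+ 2 = n%:R by rewrite sqr_sqrtr.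
split; first by rewrite divr_ge0// ltW.
rewrite /arc_scale -/s ler_pdivrMr// mulrAC ler_pdivlMr ?exprn_gt0//.
rewrite -exprS (_ : s ^+ 4 = (s ^+ 2) ^+ 2); last by rewrite -exprM.
rewrite s2 -natrX -natrM ler_nat; nia.
Qed.

(** With [s = Num.sqrt n], at most [s ^+ 4] arcs, degrees at most
    [4 * s ^+ 2] and scale at most [2 / s ^+ 3], the choice [r = s] in
    [stein_local_dependence] makes both error terms of order [1 / s]. *)
Lemma stein_arc_sum (f f' : R -> R) (K1 K2 : R) :
  (forall x : R, is_derive x 1 f (f' x)) ->
  (forall x, `|f' x| <= K1) ->
  (forall x y, `|f' x - f' y| <= K2 * `|x - y|) ->
  `|fin_expect q (fun A => arc_sum A * f (arc_sum A))
    - fin_expect q (fun A => arc_sum A ^+ 2) * fin_expect q (fun A => f' (arc_sum A))|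
  <= (16385 * K1 + 128 * K2) / Num.sqrt n%:R.
Proof.
move=> df f'K1 f'K2.
have K10 : 0 <= K1 by exact: le_trans (normr_ge0 _) (f'K1 0).
have K20 : 0 <= K2.
  by have := le_trans (normr_ge0 _) (f'K2 1 0); rewrite subr0 normr1 mulr1.
set s := Num.sqrt n%:R.
have s0 : 0 < s by rewrite sqrtr_gt0 ltr0n (ltn_trans _ n1).
have s2 : s ^+ 2 = n%:R by rewrite sqr_sqrtr.
have [c0 c1] := arc_scale_bound.
have := @stein_local_dependence _ _ q (arc_law_ge0 P D) (arc_law_sum P D) _ (@arc_adj_sym n)
  (arc_law_independent indep) (nonloops n) (4 * n) (@card_arc_adj n) arc_dev arc_dev_local
  arc_dev_bounded arc_dev_centred arc_scale c0 f f' K1 K2 s df f'K1 f'K2 s0.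
move=> /le_trans; apply.
have J4 : (#|nonloops n|)%:R <= s ^+ 4 :> R.
  by rewrite -[4%N]/(2 * 2)%N exprM s2 -natrX ler_nat card_nonloops_le.
have cX m : arc_scale ^+ m <= (2 / s ^+ 3) ^+ m by rewrite lerXn2r// nnegrE ?divr_ge0 ?exprn_ge0// ltW.
have b3 : arc_scale ^+ 3 * (#|nonloops n| * (4 * n) ^ 2)%:R <= 128 / s.
  apply: le_trans (_ : (2 / s ^+ 3) ^+ 3 * (s ^+ 4 * (4 * s ^+ 2) ^+ 2) <= _).
    apply: ler_pM => //; first exact: exprn_ge0.
    by rewrite natrM natrX natrM s2; apply: ler_pM.
  rewrite le_eqVlt; apply/orP; left; apply/eqP; field; rewrite gt_eqF//.
have b4 : arc_scale ^+ 4 * (16 * (#|nonloops n| * (4 * n) ^ 3))%:R <= 16384 / s ^+ 2.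
  apply: le_trans (_ : (2 / s ^+ 3) ^+ 4 * (16 * (s ^+ 4 * (4 * s ^+ 2) ^+ 3)) <= _).
    apply: ler_pM => //; first exact: exprn_ge0.
    by rewrite natrM ler_wpM2l// natrM natrX natrM s2; apply: ler_pM.
  rewrite le_eqVlt; apply/orP; left; apply/eqP; field; rewrite gt_eqF//.
rewrite [leRHS]mulrDl lerD//.
- rewrite [leRHS]mulrAC [leRHS]mulrC ler_wpM2l//.
  apply: le_trans (_ : s^-1 + s * (16384 / s ^+ 2) <= _).
    by rewrite lerD2l ler_wpM2l// ltW.
  rewrite le_eqVlt; apply/orP; left; apply/eqP; field; rewrite gt_eqF//.
- by rewrite [leRHS]mulrAC [leRHS]mulrC ler_wpM2l.
Qed.

End Standardized.

Local Open Scope classical_set_scope.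
Local Open Scope ring_scope.

(** * Passage to the limit *)

Section Limit.
Context {R : realType} {d : nat -> measure_display}.
Variables (T : forall n, measurableType (d n)).
Variables (P : forall n, probability (T n) R) (D : forall n, random_digraph (T n) n).
Variables (p nu : R).
Hypothesis arcp : forall n (i j : 'I_n), i != j -> arc_prob (P n) (D n) i j = p%:E.
Hypothesis indep : forall n, disjoint_arcs_independent (P n) (D n).
Hypothesis var_cvg :
  (n%:R%:E * 'V_(P n)[arc_density R (D n)])%E @[n --> \oo] --> nu%:E.

Let q n := arc_law (P n) (D n).
Arguments q n : clear implicits.
Let W n := @arc_sum R n p.
Arguments W n : clear implicits.
Let v n : R := fin_expect (q n) (fun A => W n A ^+ 2).
Let cdfW n (x : R) : R := fin_expect (q n) (fun A => (W n A <= x)%R%:R).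

Let q0 n : forall A, 0 <= q n A. Proof. exact: arc_law_ge0. Qed.
Let q1 n : \sum_A q n A = 1. Proof. exact: arc_law_sum. Qed.

Lemma v_cvg : v n @[n --> \oo] --> nu.
Proof.
suff : (v n)%:E @[n --> \oo] --> nu%:E by move/fine_cvg.
apply: cvg_trans var_cvg; apply: near_eq_cvg.
near=> n; have n1 : (1 < n)%N by near: n; exact: nbhs_infty_gt.
by rewrite (variance_arc_density n1 (arcp (n := n))).
Unshelve. all: by end_near. Qed.

Lemma probability_arc_density n x : (1 < n)%N ->
  P n [set w | Num.sqrt n%:R * (arc_density R (D n) w - p) <= x] = (cdfW n x)%:E.
Proof.
move=> n1; rewrite -(probability_arcs (P n) (D n) (fun A => W n A <= x)).
by congr (P n _); apply/seteqP; split => w /=; rewrite arc_sumE.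
Qed.

Lemma inv_sqrtn_cvg : (Num.sqrt n%:R)^-1 @[n --> \oo] --> (0 : R).
Proof.
apply/cvgrPdist_le => e e0; near=> n.
rewrite sub0r normrN ger0_norm ?invr_ge0// invf_ple ?posrE//; last first.
  by rewrite sqrtr_gt0 ltr0n; near: n; exact: nbhs_infty_gt.
rewrite -(ler_pXn2r (n := 2))// ?nnegrE ?invr_ge0 ?(ltW e0)// sqr_sqrtr//.
by near: n; exact: nbhs_infty_ger.
Unshelve. all: by end_near. Qed.

Section Nondegenerate.
Hypothesis nu0 : 0 < nu.
Let s := Num.sqrt nu.
Let s0 : 0 < s. Proof. by rewrite sqrtr_gt0. Qed.
Let s2 : s ^+ 2 = nu. Proof. by rewrite sqr_sqrtr// ltW. Qed.

(** Take the expectation of Stein's equation at [W]: its left-hand side tends to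
    0, as [E (W f W)] is close to [v n * E (f' W)] and [v n] to [nu]. *)
Lemma ramp_mean_cvg a b : 0 < a -> a < b -> b < 1 ->
  fin_expect (q n) (fun A => ramp a b (normal_cdf s (W n A))) @[n --> \oo] --> (a + b) / 2.
Proof.
move=> a0 ab b1; pose f := stein_sol s a b; pose f' := stein_sol' s a b.
have df (x : R) : is_derive x 1 f (f' x) by exact: is_derive_stein_sol.
have f'2 x : `|f' x| <= 2 by exact: stein_sol'_bounded.
have [K f'K] := stein_sol'_lipschitz s0 a0 ab b1.
pose C := 16385 * 2 + 128 * K.
pose B n := `|1 - nu^-1 * v n| * 2 + nu^-1 * (C * (Num.sqrt n%:R)^-1).
have Bcvg : B n @[n --> \oo] --> (0 : R).
  have h1 : (1 - nu^-1 * v n) @[n --> \oo] --> (0 : R).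
    have h : (1 - nu^-1 * v n) @[n --> \oo] --> 1 - nu^-1 * nu.
      by apply: cvgB; [exact: cvg_cst|apply: cvgM; [exact: cvg_cst|exact: v_cvg]].
    by rewrite mulVf ?subrr ?gt_eqF// in h.
  have : B n @[n --> \oo] --> `|0 : R| * 2 + nu^-1 * (C * 0).
    apply: cvgD; first by apply: cvgM; [exact: cvg_norm|exact: cvg_cst].
    apply: cvgM; first exact: cvg_cst.
    by apply: cvgM; [exact: cvg_cst|exact: inv_sqrtn_cvg].
  by rewrite normr0 mul0r !mulr0 addr0.
apply/cvgrPdist_le => e e0; near=> n.
apply: le_trans (_ : B n <= _); last first.
  by near: n; move/cvgrPdist_le : Bcvg => /(_ _ e0); apply: filterS => n;
     rewrite sub0r normrN; apply: le_trans; exact: ler_norm.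
have n1 : (1 < n)%N by near: n; exact: nbhs_infty_gt.
have := stein_arc_sum n1 (@arcp n) (@indep n) df f'2 f'K.
rewrite -/(q n) -/(W n) -/(v n) -/C => bound.
set Ef' := fin_expect _ (fun A => f' _) in bound.
set EWf := fin_expect _ (fun A => _ * f _) in bound.
have eqn : fin_expect (q n) (fun A => ramp a b (normal_cdf s (W n A))) - (a + b) / 2 =
    Ef' - nu^-1 * EWf.
  rewrite -fin_expectZ -fin_expectB -[X in _ - X](fin_expect_cst (@q1 n)) -fin_expectB.
  apply: eq_fin_expect => A; rewrite -(stein_equation s a b) s2 mulrA; congr (_ - _).
rewrite distrC eqn.
have -> : Ef' - nu^-1 * EWf = (1 - nu^-1 * v n) * Ef' - nu^-1 * (EWf - v n * Ef') by ring.
apply: le_trans (ler_normB _ _) _; apply: lerD.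
- by rewrite normrM ler_wpM2l//; apply: fin_expect_bounded.
- by rewrite normrM ger0_norm ?invr_ge0 ?(ltW nu0)// ler_wpM2l ?invr_ge0 ?(ltW nu0).
Unshelve. all: by end_near. Qed.

(** The indicator of [W <= x] lies between the ramps that fall just before and
    just after the level [normal_cdf s x]. *)
Lemma cdfW_cvg_normal x : cdfW n x @[n --> \oo] --> normal_cdf s x.
Proof.
set u := normal_cdf s x.
have u0 : 0 < u by exact: normal_cdf_gt0.
have u1 : u < 1 by exact: normal_cdf_lt1.
apply/cvgrPdist_le => e e0.
pose dl := Num.min e (Num.min (u / 2) ((1 - u) / 2)).
have dl0 : 0 < dl by rewrite !lt_min e0 !divr_gt0// subr_gt0.
have dle : dl <= e by rewrite ge_min lexx.
have dlu : dl <= u / 2 by rewrite !ge_min lexx orbT.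
have dlu' : dl <= (1 - u) / 2 by rewrite !ge_min lexx !orbT.
have up := @ramp_mean_cvg u (u + dl) u0 ltac:(lra) ltac:(lra).
have lo := @ramp_mean_cvg (u - dl) u ltac:(lra) ltac:(lra) u1.
have dl2 : 0 < dl / 2 by rewrite divr_gt0.
move/cvgrPdist_le : up => /(_ _ dl2) up; move/cvgrPdist_le : lo => /(_ _ dl2) lo.
near=> n.
have upn : `|(u + (u + dl)) / 2 - fin_expect (q n) (fun A => ramp u (u + dl) (normal_cdf s (W n A)))| <= dl / 2.
  by near: n.
have lon : `|(u - dl + u) / 2 - fin_expect (q n) (fun A => ramp (u - dl) u (normal_cdf s (W n A)))| <= dl / 2.
  by near: n.
have le1 : cdfW n x <= fin_expect (q n) (fun A => ramp u (u + dl) (normal_cdf s (W n A))).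
  apply: le_fin_expect => // A; have [Wx|xW] := leP (W n A) x.
    rewrite ramp_left//; first by lra.
    by move: Wx; rewrite le_eqVlt => /predU1P[->//|/(normal_cdf_mono s0)/ltW].
  by have /andP[] := @ramp_bound _ u (u + dl) (normal_cdf s (W n A)) ltac:(lra).
have le2 : fin_expect (q n) (fun A => ramp (u - dl) u (normal_cdf s (W n A))) <= cdfW n x.
  apply: le_fin_expect => // A; have [Wx|xW] := leP (W n A) x.
    by have /andP[] := @ramp_bound _ (u - dl) u (normal_cdf s (W n A)) ltac:(lra).
  rewrite ramp_right//; first by lra.
  exact/ltW/normal_cdf_mono.
move: upn lon; rewrite !ler_norml => /andP[? ?] /andP[? ?].
apply/andP; split; lra.
Unshelve. all: by end_near. Qed.

End Nondegenerate.

(** Chebyshev's inequality: the indicator of [W <= x] differs from its limit only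
    if [`|x| <= `|W|], hence by at most [W ^+ 2 / x ^+ 2]. *)
Lemma cdfW_cvg_dirac (x : R) : nu = 0 -> x != 0 ->
  cdfW n x @[n --> \oo] --> ((0 <= x)%R%:R : R).
Proof.
move=> nu0 x0.
have x2 : 0 < x ^+ 2 by rewrite exprn_even_gt0.
have Bcvg : v n / x ^+ 2 @[n --> \oo] --> (0 : R).
  have : v n / x ^+ 2 @[n --> \oo] --> nu / x ^+ 2.
    by apply: cvgM; [exact: v_cvg|exact: cvg_cst].
  by rewrite nu0 mul0r.
apply/cvgrPdist_le => e e0; near=> n.
apply: le_trans (_ : v n / x ^+ 2 <= _); last first.
  by near: n; move/cvgrPdist_le : Bcvg => /(_ _ e0); apply: filterS => n;
     rewrite sub0r normrN; apply: le_trans; exact: ler_norm.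
have -> : v n / x ^+ 2 = fin_expect (q n) (fun A => (x ^+ 2)^-1 * W n A ^+ 2).
  by rewrite fin_expectZ mulrC.
rewrite -[X in `|X - _|](fin_expect_cst (@q1 n)) -fin_expectB.
apply: le_trans (ler_norm_fin_expect (@q0 n) _) _; apply: le_fin_expect => // A.
have WX : (`|x| <= `|W n A|) -> 1 <= (x ^+ 2)^-1 * W n A ^+ 2.
  move=> xW; rewrite mulrC ler_pdivlMr// mul1r.
  by rewrite -(real_normK (num_real x)) -(real_normK (num_real (W n A))) lerXn2r.
have W0 : 0 <= (x ^+ 2)^-1 * W n A ^+ 2 by rewrite mulr_ge0 ?sqr_ge0// invr_ge0 ltW.
have [xneg|xpos] := ltP x 0.
- rewrite sub0r normrN; have [Wx|_] := leP (W n A) x; last by rewrite normr0.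
  rewrite normr1; apply: WX.
  rewrite !ler0_norm ?lerN2// ltW//; exact: le_lt_trans Wx _.
- have [Wx|xW] := leP (W n A) x; first by rewrite subrr normr0.
  rewrite subr0 normr1; apply: WX.
  by rewrite !ger0_norm ?(ltW xW)// (le_trans xpos)// ltW.
Unshelve. all: by end_near. Qed.

Lemma nu_ge0 : 0 <= nu.
Proof.
apply: (cvgr_to_ge v_cvg); apply: nearW => n.
by apply: fin_expect_ge0 => // A; exact: sqr_ge0.
Qed.

End Limit.

Lemma arc_density_Ustatistic2 d (T : measurableType d) (R : realType) n
    (D : random_digraph T n) : (1 < n)%N ->
  is_Ustatistic2 (arc_kernel R D) (arc_density R D).
Proof.
move=> n1.
have mind i j : measurable_fun setT (arc_ind R D i j).
  by apply: measurable_indic; exact: (measurable_arcs D (fun A => (i, j) \in A)).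
split=> [i j|i j|w].
- apply: measurable_funM => //; exact: measurable_funD.
- by apply/funext => w; rewrite /arc_kernel addrC.
- have binE : (n * (n - 1))%:R = 'C(n, 2)%:R * 2 :> R.
    by rewrite -natrM -[2%N]/(2`!) bin_ffact ffactnS ffactn1 subn1.
  rewrite arc_densityE binE invfM -mulrA; congr (_ * _).
  pose g (i j : 'I_n) : R := ((i, j) \in arcs (D w))%:R.
  have -> : \sum_(e in nonloops n) (e \in arcs (D w))%:R =
      \sum_(i < n) \sum_(j < n | (i < j)%N) g i j +
      \sum_(i < n) \sum_(j < n | (j < i)%N) g i j.
    transitivity (\sum_(i < n) \sum_(j < n | i != j) g i j).
      by rewrite pair_big_dep; apply: eq_big => [e|[i j] _]; rewrite ?inE.
    rewrite -big_split; apply: eq_bigr => i _ /=.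
    rewrite (bigID (fun j : 'I_n => (i < j)%N))/=; congr (_ + _);
      apply: eq_bigl => j; rewrite -val_eqE/=; lia.
  rewrite [X in _ + X](exchange_big_dep xpredT)//= -big_split/= mulr_sumr.
  apply: eq_bigr => i _; rewrite -big_split/= mulr_sumr; apply: eq_bigr => j _.
  by rewrite /arc_kernel (arc_indE D (i, j)) (arc_indE D (j, i)) mulrC.
Qed.

Lemma dirac_cdf_discontinuous (R : realType) :
  ~ {for 0, continuous (fun y : R => (\d_(0 : measurableTypeR R) : probability _ R) [set z | z <= y])}.
Proof.
move=> h.
pose f (y : R) : R := (0 <= y)%R%:R.
have fE : (fun y : R => (\d_(0 : measurableTypeR R) : probability _ R)
    [set z | z <= y]) = EFin \o f.
  apply/funext => y; rewrite /= diracE; congr ((nat_of_bool _)%:R)%:E.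
  by apply/idP/idP; rewrite inE.
rewrite fE in h.
have {}h : f y @[y --> (0 : R)] --> f 0 by have /fine_cvg := h.
have f0 : f 0 = 1 by rewrite /f lexx.
rewrite f0 in h.
have := cvgr_gt _ h (1 / 2) ltac:(lra).
move=> /nbhs_ballP[e /= e0] /(_ (- (e / 2))).
rewrite /ball/= sub0r normrN normrN ger0_norm ?divr_ge0 ?(ltW e0)//.
rewrite /f oppr_ge0 leNgt divr_gt0//= mulr0n => /(_ ltac:(lra)).
lra.
Qed.

Theorem theorem2p2 (R : realType) :
  (forall (n : nat) (d : measure_display) (T : measurableType d)
      (P : probability T R) (D : random_digraph T n),
    (1 < n)%N ->
    is_Ustatistic2 (arc_kernel R D) (arc_density R D) /\
    (forall p : R,
      (forall i j : 'I_n, i != j -> arc_prob P D i j = p%:E) ->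
      unbiased_estimator P (arc_density R D) p))
  /\
  (forall (d : nat -> measure_display) (T : forall n, measurableType (d n))
      (P : forall n, probability (T n) R)
      (D : forall n, random_digraph (T n) n) (p nu : R),
    (forall n (i j k l : 'I_n), i != j -> k != l ->
      identically_distributed (P n)
        (arc_ind R (D n) i j) (arc_ind R (D n) k l)) ->
    (forall n (i j : 'I_n), i != j -> arc_prob (P n) (D n) i j = p%:E) ->
    (forall n, disjoint_arcs_independent (P n) (D n)) ->
    (forall n (i j k l : 'I_n), i != j -> k != l ->
      #|[set i; j]%SET :&: [set k; l]%SET| = 1%N ->
      (0 < covariance (P n) (arc_ind R (D n) i j) (arc_ind R (D n) k l))%E) ->
    (n%:R%:E * 'V_(P n)[arc_density R (D n)])%E @[n --> \oo] --> nu%:E ->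
    cvg_in_law P (fun n w => Num.sqrt n%:R * (arc_density R (D n) w - p))
      (normal_law 0 nu)).
Proof.
split=> [n d T P D n1|d T P D p nu _ arcp indep _ var_cvg].
  split=> [|p arcp]; last exact: expectation_arc_density.
  exact: arc_density_Ustatistic2.
move=> x xcont.
have nu0 := nu_ge0 arcp var_cvg.
suff : P n [set w | Num.sqrt n%:R * (arc_density R (D n) w - p) <= x] @[n --> \oo]
    --> normal_law 0 nu [set z | z <= x] by [].
pose F n : R := fin_expect (arc_law (P n) (D n)) (fun A => (@arc_sum R n p A <= x)%R%:R).
(* The two sides agree as soon as [1 < n]; below that, the scale is 0. *)
have near_cdf (l : R) : F n @[n --> \oo] --> l ->
  P n [set w | Num.sqrt n%:R * (arc_density R (D n) w - p) <= x] @[n --> \oo] --> l%:E.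
  move=> h; apply: (@cvg_trans _ ((F n)%:E @[n --> \oo])); last first.
    by apply: cvg_EFin => //; near=> n.
  apply: near_eq_cvg; near=> n; rewrite probability_arc_density//.
  by near: n; exact: nbhs_infty_gt.
move: nu0; rewrite le_eqVlt => /predU1P[nu0|nu0].
- have x0 : x != 0.
    apply/eqP => x0; apply: (@dirac_cdf_discontinuous R).
    by move: xcont; rewrite x0 /normal_law -nu0 eqxx.
  have -> : normal_law 0 nu [set z | z <= x] = (((0 <= x)%R)%:R)%:E.
    rewrite /normal_law -nu0 eqxx /= diracE; congr ((nat_of_bool _)%:R)%:E.
    by apply/idP/idP; rewrite inE.
  by apply: near_cdf; apply: (cdfW_cvg_dirac arcp var_cvg).
- have -> : normal_law 0 nu [set z | z <= x] = (normal_cdf (Num.sqrt nu) x)%:E.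
    rewrite normal_cdfE /normal_law gt_eqF//=; congr normal_prob.
  by apply: near_cdf; apply: (cdfW_cvg_normal arcp indep var_cvg).
Unshelve. all: by end_near. Qed.
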